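(* Let $P$ be a convex rational polytope in $\mathbb{R}^d=\mathbb{R}^{d-1}\times\mathbb{R}$ of dimension $d$. For $\lambda\in\mathbb{Q}_{\geq0}$ let $P_\lambda:=P\cap\{z=\lambda\}\subset\mathbb{R}^{d-1}\times\{\lambda\}$ and let $$i(P_\lambda,n)=\sum_{i=0}^{\dim(P_\lambda)}C_i(P_\lambda,n)n^i,\qquad n\in\mathbb{Z}_{\geq0},$$ be the Ehrhart quasi-polynomial of $P_\lambda$. Then there are constants $\tilde c_i(P)$ for $0\leq i\leq d-1$, depending only on $P$ and $i$ (not on $\lambda$ or $n$), and constants $\tilde c_{d-1}(P_\lambda)$, independent of $n$, such that for all $\lambda\in\mathbb{Q}_{\geq 0}$ and all $0\leq i\leq d-1$, $$|C_i(P_\lambda,n)|\leq\tilde c_i(P)\quad\text{and}\quad C_{d-1}(P_\lambda,n)=\tilde c_{d-1}(P_\lambda),\quad\text{provided }\lambda n\in\mathbb{Z}_{\geq0}.$$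
   Context: Here $z$ is the last coordinate on $\mathbb{R}^d$. A polytope is rational if its vertices have rational coordinates. For a rational polytope $Q\subset\mathbb{R}^d$, $i(Q,n)=\#(nQ\cap\mathbb{Z}^d)$ for $n\in\mathbb{Z}_{\geq0}$; by Ehrhart's theorem it is a quasi-polynomial, i.e. $i(Q,n)=\sum_{i=0}^{\dim Q}C_i(Q,n)n^i$ where each coefficient $C_i(Q,n)$ is periodic in $n$. Convention: $C_i(Q,n)=0$ for $i>\dim Q$, and all $C_i(Q,n)=0$ if $Q$ is empty. *)

(* Defs.v *)
From HB Require Import structures.
From mathcomp Require Import all_boot all_order all_algebra.
From mathcomp Require Import finmap.
From mathcomp Require Import all_classical all_reals.

Set Implicit Arguments.
Unset Strict Implicit.
Unset Printing Implicit Defensive.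

Import Order.TTheory GRing.Theory Num.Theory.
Local Open Scope classical_set_scope.
Local Open Scope ring_scope.

Definition convex_hull (R : realType) (n k : nat) (v : 'I_k -> 'rV[R]_n) :
    set 'rV[R]_n :=
  [set x | exists w : 'I_k -> R,
     [/\ forall i, 0 <= w i, \sum_i w i = 1 & x = \sum_i w i *: v i]].

Definition convex_polytope (R : realType) (n : nat) (P : set 'rV[R]_n) : Prop :=
  exists (k : nat) (v : 'I_k -> 'rV[R]_n), P = convex_hull v.

(* The vertices of a convex polytope are its extreme points. *)
Definition vertex (R : realType) (n : nat) (P : set 'rV[R]_n) (x : 'rV[R]_n) :
    Prop :=
  P x /\ forall (y z : 'rV[R]_n) (t : R),
    P y -> P z -> 0 < t < 1 -> x = t *: y + (1 - t) *: z -> y = z.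

Definition rational_polytope (R : realType) (n : nat) (P : set 'rV[R]_n) : Prop :=
  convex_polytope P /\
  forall x, vertex P x -> forall j, exists q : rat, x 0 j = ratr q.

Definition affinely_independent (R : realType) (n k : nat)
    (p : 'I_k.+1 -> 'rV[R]_n) : bool :=
  row_free (\matrix_(i < k) (p (lift ord0 i) - p ord0)).

(* The largest k such that Q contains k+1 affinely independent points, that is
   the dimension of the affine hull of Q; the empty set gets the value 0. *)
Definition affine_dim (R : realType) (n : nat) (Q : set 'rV[R]_n) : nat :=
  \max_(k < n.+1 | `[< exists p : 'I_k.+1 -> 'rV[R]_n,
                         (forall i, Q (p i)) /\ affinely_independent p >]) k.

Definition integer_lattice (R : realType) (n : nat) : set 'rV[R]_n :=
  [set x | forall j, x 0 j \is a Num.int].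

Definition dilate (R : realType) (n : nat) (Q : set 'rV[R]_n) (m : nat) :
    set 'rV[R]_n :=
  [set m%:R *: x | x in Q].

(* For an infinite set of lattice points [fset_set] is empty; this does not
   happen for the bounded sets Q considered here. *)
Definition lattice_count (R : realType) (n : nat) (Q : set 'rV[R]_n) (m : nat) :
    nat :=
  #|` fset_set (dilate Q m `&` @integer_lattice R n)|.

(* [C i m] is the value at m of the i-th coefficient function. *)
Definition is_ehrhart (R : realType) (n : nat) (Q : set 'rV[R]_n)
    (C : nat -> nat -> R) : Prop :=
  [/\ forall m, (lattice_count Q m)%:R = \sum_(i < (affine_dim Q).+1) C i m * m%:R ^+ i,
      forall i, exists2 N, (0 < N)%N & forall m, C i (m + N)%N = C i m,
      forall i, (affine_dim Q < i)%N -> forall m, C i m = 0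
    & Q = set0 -> forall i m, C i m = 0].

Lemma is_ehrhart_unique (R : realType) (n : nat) (Q : set 'rV[R]_n)
    (C C' : nat -> nat -> R) :
  is_ehrhart Q C -> is_ehrhart Q C' -> C = C'.
Proof.
move=> [cC pC zC _] [cC' pC' zC' _].
apply/funext => i; apply/funext => m.
have [ltdi|ledi] := ltnP (affine_dim Q) i; first by rewrite zC ?zC'.
have period (F : nat -> nat -> R) :
    (forall i, exists2 N, (0 < N)%N & forall m, F i (m + N)%N = F i m) ->
    exists N : nat -> nat, forall i, (0 < N i)%N /\
      forall k m, F i (m + k * N i)%N = F i m.
  move=> pF; have /choice[N HN] : forall i, exists N, (0 < N)%N /\
      forall m, F i (m + N)%N = F i m.
    by move=> j; have [N ? ?] := pF j; exists N.
  exists N => j; have [N0 HF] := HN j; split=> //.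
  by elim=> [|k IH] p; rewrite ?addn0 // mulSn addnCA addnC HF IH.
have [N HN] := period _ pC; have [N' HN'] := period _ pC'.
pose T := (\prod_(j < (affine_dim Q).+1) (N j * N' j))%N.
have T0 : (0 < T)%N.
  by apply: prodn_gt0 => j; rewrite muln_gt0 (HN j).1 (HN' j).1.
have dT (j : 'I_(affine_dim Q).+1) : exists t, T = (t * (N j * N' j))%N.
  exists (\prod_(l < (affine_dim Q).+1 | l != j) (N l * N' l))%N.
  by rewrite /T (bigD1 j) //= mulnC.
pose p : {poly R} := \poly_(j < (affine_dim Q).+1) (C j m - C' j m).
have rp k : root p (m + k * T)%:R.
  rewrite /root horner_poly; apply/eqP.
  transitivity (\sum_(j < (affine_dim Q).+1) C j (m + k * T)%N * (m + k * T)%:R ^+ j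
     - \sum_(j < (affine_dim Q).+1) C' j (m + k * T)%N * (m + k * T)%:R ^+ j).
    rewrite -sumrB; apply: eq_bigr => j _; rewrite -mulrBl.
    have [t ->] := dT j.
    have -> : (k * (t * (N j * N' j)) = (k * t * N' j) * N j)%N.
      by rewrite -!mulnA [(N j * _)%N]mulnC.
    rewrite (HN j).2 -[(k * t * _ * _)%N]mulnA [(N' j * _)%N]mulnC !mulnA.
    by rewrite (HN' j).2.
  by rewrite -cC -cC' subrr.
have p0 : p = 0.
  apply: contrapT => /eqP p0.
  have := max_poly_roots p0 (rs := [seq (m + k * T)%:R | k <- iota 0 (size p)]).
  rewrite size_map size_iota ltnn => H; suff: false by [].
  apply: H; first by apply/allP => x /mapP[k _ ->].
  rewrite map_inj_uniq ?iota_uniq // => a b /eqP.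
  by rewrite eqr_nat eqn_add2l eqn_pmul2r // => /eqP.
move/polyP: p0 => /(_ i); rewrite coef_poly ltnS ledi coef0.
by move/eqP; rewrite subr_eq0 => /eqP.
Qed.

(* C_i(Q, m): the coefficients are unique by [is_ehrhart_unique] and exist for
   rational polytopes by Ehrhart's theorem; the default value 0 is only used for
   sets Q without an Ehrhart quasi-polynomial. *)
Definition ehrhart_coef (R : realType) (n : nat) (Q : set 'rV[R]_n) :
    nat -> nat -> R :=
  xget (fun _ _ => 0) [set C | is_ehrhart Q C].

(* P_lambda, as a subset of the ambient space (z is the last coordinate). *)
Definition slice (R : realType) (d : nat) (P : set 'rV[R]_d.+1) (lambda : rat) :
    set 'rV[R]_d.+1 :=
  P `&` [set x | x 0 ord_max = ratr lambda].

(* Main.v *)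
Require Import Defs.
From mathcomp Require Import all_boot all_order all_algebra.
From mathcomp Require Import finmap.
From mathcomp Require Import all_classical all_reals.
From mathcomp Require Import ring lra zify.
From mathcomp Require polyrcf.

(** Let [f(z, N)] be the number of lattice points of height [z] in [N P]. For the
    slice at height [lam], the count at [N] is [f(lam N, N)]. The bound on the
    coefficients, uniform in [lam], comes from the fact that [f] is a single
    piecewise quasi-polynomial in both variables.

    Indeed, the pairs [(x, N)] with [x] in [N P] form a rational cone, which is cut
    out by finitely many integer inequalities ([rational_polytope_inequalities]),
    and [f] arises from the indicator of this cone by summing over all coordinates
    of [x] but the height. The algebra generated by affine forms and by indicators
    of affine inequalities and congruences is closed under such summations
    ([pqp_partial_sum]): a summand can be rewritten so that it has only one lower
    bound in the variable of summation, and then it telescopes. So [f] belongs to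
    the algebra ([pqp_slice_points]).

    On a ray [z = lam N], with [N] restricted to a suitable arithmetic progression,
    inequalities and congruences are eventually constant and affine forms become
    polynomials in [N] whose coefficients are affine in [lam]. Hence [f(lam N, N)]
    is eventually a polynomial in [N] whose coefficients are bounded in terms of a
    bound on [lam] alone ([pqp_along_ray]). It is the Ehrhart polynomial on the
    residue class, and [lam] is bounded on nonempty slices because [P] is bounded
    ([slice_coef_bounded]).

    The coefficient of degree [d] can be nonzero only if the slice has dimension
    [d]. Then every large dilate [K Q] of the slice [Q], with [lam K] an integer,
    contains a lattice point ([lattice_point_in_dilate]), and translation by it
    embeds the lattice points of [N Q] into those of [(N + K) Q]. So the counts on
    any two residue classes bound each other up to a shift of [N], and their leading
    coefficients are equal ([slice_top_coef_le]). *)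

Set Implicit Arguments.
Unset Strict Implicit.
Unset Printing Implicit Defensive.

Import Order.TTheory GRing.Theory Num.Theory.
Local Open Scope classical_set_scope.
Local Open Scope ring_scope.

(** * Univariate quasi-polynomials *)

Definition antidifferentiable (R : realType) (p : {poly R}) : Prop :=
  exists q : {poly R}, forall x, q.[x + 1] - q.[x] = p.[x].

Lemma antidifferentiable_lincomb (R : realType) (n : nat) (c : nat -> R)
    (p : nat -> {poly R}) :
  (forall i, (i < n)%N -> antidifferentiable (p i)) ->
  antidifferentiable (\sum_(i < n) c i *: p i).
Proof.
elim: n => [|n IH] pn; first by exists 0 => x; rewrite big_ord0 !horner0 subrr.
have [q qP] := IH (fun i lt => pn i (leqW lt)).
have [r rP] := pn n (leqnn _).
exists (q + c n *: r) => x.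
rewrite big_ord_recr /= !hornerE -qP -rP; ring.
Qed.

(** Telescoping: the difference of ['X^k.+1] is [(k + 1) 'X^k] plus lower
    monomials, which have antidifferences by induction. *)
Lemma antidifferentiableXn (R : realType) (k : nat) :
  antidifferentiable ('X^k : {poly R}).
Proof.
elim/ltn_ind: k => k IH.
have [q qP] := antidifferentiable_lincomb (fun i => ('C(k.+1, i))%:R) IH.
exists (k.+1%:R^-1 *: ('X^(k.+1) - q)) => x.
have k0 : (k.+1%:R : R) != 0 by rewrite pnatr_eq0.
apply: (mulfI k0); rewrite !hornerE -mulrBr mulrA mulfV // mul1r.
have -> : (x + 1) ^+ k.+1 - q.[x + 1] - (x ^+ k.+1 - q.[x]) =
    (x + 1) ^+ k.+1 - x ^+ k.+1 - (q.[x + 1] - q.[x]) by ring.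
rewrite qP exprD1n !big_ord_recr /= binn mulr1n binSn horner_sum.
under [X in _ - X]eq_bigr do rewrite hornerZ hornerXn mulr_natl.
rewrite -[_ *+ k.+1]mulr_natl; ring.
Qed.

Lemma poly_antidifference (R : realType) (p : {poly R}) :
  exists2 q : {poly R}, q.[0] = 0 & forall x, q.[x + 1] - q.[x] = p.[x].
Proof.
have [q qP] := antidifferentiable_lincomb (n := size p) (nth 0 p)
  (fun i _ => antidifferentiableXn R i).
exists (q - q.[0]%:P) => [|x]; first by rewrite !hornerE subrr.
rewrite !hornerE -[p in RHS]coefK poly_def -qP; ring.
Qed.

(** Asking for a polynomial for every integer [r], not only for [0 <= r < M], is
    equivalent and makes shifts of the argument harmless. *)
Definition quasi_poly (R : realType) (phi : int -> R) : Prop :=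
  exists2 M : nat, (0 < M)%N &
    forall r : int, exists p : {poly R}, forall t : int,
      phi (t * M%:Z + r) = p.[t%:~R].

Lemma quasi_poly_cst (R : realType) (c : R) : quasi_poly (fun=> c).
Proof. by exists 1%N => // r; exists c%:P => t; rewrite hornerC. Qed.

Lemma quasi_poly_id (R : realType) : quasi_poly (fun x => x%:~R : R).
Proof.
by exists 1%N => // r; exists ('X + r%:~R%:P) => t; rewrite mulr1 intrD !hornerE.
Qed.

Lemma quasi_poly_dvd (R : realType) (M : nat) (a c : int) : (0 < M)%N ->
  quasi_poly (fun x => (M%:Z %| a * x + c)%Z%:R : R).
Proof.
move=> M0; exists M => // r; exists ((M%:Z %| a * r + c)%Z%:R)%:P => t.
have -> : a * (t * M%:Z + r) + c = (a * t) * M%:Z + (a * r + c) by ring.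
by rewrite hornerC rpredDl ?dvdz_mull.
Qed.

(** Both factors are polynomial on the classes modulo the product of the two
    periods. *)
Lemma quasi_polyM (R : realType) (phi psi : int -> R) :
  quasi_poly phi -> quasi_poly psi -> quasi_poly (fun x => phi x * psi x).
Proof.
move=> [M M0 HM] [N N0 HN]; exists (M * N)%N => [|r]; first by rewrite muln_gt0 M0.
have [p pP] := HM r; have [q qP] := HN r.
exists ((p \Po (N%:R *: 'X)) * (q \Po (M%:R *: 'X))) => t.
have -> : t * (M * N)%N%:Z + r = (t * N%:Z) * M%:Z + r.
  by rewrite PoszM; ring.
rewrite pP -mulrA [N%:Z * _]mulrC mulrA qP.
by rewrite hornerM !horner_comp !hornerE !intrM ![_ * t%:~R]mulrC.
Qed.

(** The argument is the ceiling of [- x / a], the least integer [t] with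
    [0 <= a * t + x]: this is the lower end of the range that a cut imposes on a
    summation variable. *)
Lemma quasi_poly_ceil (R : realType) (phi : int -> R) (a : nat) : (0 < a)%N ->
  quasi_poly phi -> quasi_poly (fun x => phi (- (x %/ a%:Z)%Z)).
Proof.
move=> a0 [M M0 HM]; exists (M * a)%N => [|r]; first by rewrite muln_gt0 M0.
have [p pP] := HM (- (r %/ a%:Z)%Z).
exists (p \Po (- 'X)) => t.
have -> : t * (M * a)%N%:Z + r = (t * M%:Z) * a%:Z + r by rewrite PoszM; ring.
rewrite divzMDl ?eqz_nat -?lt0n // horner_comp !hornerE opprD -mulNr pP.
by rewrite intrN.
Qed.

(** Over one full period, [phi] adds up to a polynomial in the quotient, which
    has a polynomial antidifference [q]; the incomplete period at the end is a
    finite sum of values of [phi], hence polynomial on each residue class. *)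
Lemma quasi_poly_antidifference (R : realType) (phi : int -> R) :
  quasi_poly phi -> exists Phi : int -> R, [/\ quasi_poly Phi, Phi 0 = 0 &
    forall x, Phi (x + 1) = Phi x + phi x].
Proof.
move=> [M M0 HM]; have [p pP] := choice HM.
have M0' : M%:Z != 0 by rewrite eqz_nat -lt0n.
have [q q0 qP] := poly_antidifference (\sum_(i < M) p i%:Z).
pose Phi (x : int) := q.[(x %/ M%:Z)%Z%:~R] +
  \sum_(i < `|(x %% M%:Z)%Z|%N) (p i%:Z).[(x %/ M%:Z)%Z%:~R].
have PhiE (t : int) (r : nat) : (r < M)%N ->
    Phi (t * M%:Z + r%:Z) = q.[t%:~R] + \sum_(i < r) (p i%:Z).[t%:~R].
  move=> rM; rewrite /Phi divzMDl // modzMDl divz_small ?addr0; last first.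
    by rewrite le0z_nat ltz_nat.
  by rewrite modz_small // le0z_nat ltz_nat.
exists Phi; split.
- exists M => // r.
  pose j := (r %/ M%:Z)%Z; pose s := `|(r %% M%:Z)%Z|%N.
  exists (q \Po ('X + j%:~R%:P) + \sum_(i < s) (p i%:Z \Po ('X + j%:~R%:P))) => t.
  have -> : t * M%:Z + r = (t + j) * M%:Z + s%:Z.
    rewrite /s gez0_abs ?modz_ge0 // {1}(divz_eq r M%:Z) /j; ring.
  rewrite PhiE; last first.
    by rewrite /s -ltz_nat gez0_abs ?modz_ge0 // ltz_pmod.
  rewrite hornerD horner_comp horner_sum !hornerE intrD; congr (_ + _).
  by apply: eq_bigr => i _; rewrite horner_comp !hornerE.
- by rewrite -[0]addr0 -{1}(mul0r M%:Z) PhiE // big_ord0 addr0 q0.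
- move=> x; rewrite (divz_eq x M%:Z).
  set t := (x %/ _)%Z.
  have [r [-> rM]] : exists r : nat, (x %% M%:Z)%Z = r%:Z /\ (r < M)%N.
    exists `|(x %% M%:Z)%Z|%N; rewrite -ltz_nat gez0_abs ?modz_ge0 //.
    by rewrite ltz_pmod.
  rewrite [X in _ = X + _]PhiE // pP.
  have [rM1|] := ltnP r.+1 M.
    have -> : t * M%:Z + r%:Z + 1 = t * M%:Z + r.+1%:Z by lia.
    rewrite PhiE // big_ord_recr /=; ring.
  move=> Mr; have {}Mr : M = r.+1 by apply/eqP; rewrite eqn_leq Mr.
  have -> : t * M%:Z + r%:Z + 1 = (t + 1) * M%:Z + 0%:Z by rewrite Mr; lia.
  rewrite PhiE // big_ord0 addr0 intrD.
  have := qP t%:~R; rewrite horner_sum => /eqP.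
  rewrite subr_eq => /eqP ->; subst M; rewrite big_ord_recr /=; ring.
Qed.

(** Only the residue of [z] itself survives among the residues below [M]. This
    turns a dependence on a residue into divisibility conditions. *)
Lemma sum_residues (R : realType) (M : nat) (z : int) (f : nat -> R) : (0 < M)%N ->
  \sum_(r < M) (M%:Z %| 1 * z + - r%:Z)%Z%:R * f r = f `|(z %% M%:Z)%Z|%N.
Proof.
move=> M0; have MZ0 : M%:Z != 0 by rewrite eqz_nat -lt0n.
set t := (z %/ M%:Z)%Z; have [r [rE zE rM]] : exists r : nat,
    [/\ (z %% M%:Z)%Z = r%:Z, z = t * M%:Z + r%:Z & (r < M)%N].
  exists `|(z %% M%:Z)%Z|%N.
  by rewrite -ltz_nat gez0_abs ?modz_ge0 // ltz_pmod // -divz_eq.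
rewrite rE (bigD1 (Ordinal rM)) //= big1 ?addr0 => [|i /eqP ir].
  by rewrite mul1r {1}zE addrK dvdz_mull // mul1r.
rewrite mul1r zE -addrA.
have -> : (M%:Z %| t * M%:Z + (r%:Z - i%:Z))%Z = (M%:Z %| r%:Z - i%:Z)%Z.
  by rewrite rpredDl ?dvdz_mull.
case: (boolP (M%:Z %| r%:Z - i%:Z)%Z) => [/dvdzP[k kE]|_]; last by rewrite mul0r.
(* two residues below M differ by a multiple of M only if they are equal *)
exfalso; apply: ir; apply/val_inj => /=; have := ltn_ord i => iM.
have [k0|[k0|k0]] : k = 0 \/ (1 <= k \/ k <= -1) by lia.
- by move: kE; rewrite k0; lia.
- by nia.
- by nia.
Qed.

(** * Piecewise quasi-polynomials *)

Definition affine_closed (E : Type) (L : (E -> int) -> Prop) : Prop :=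
  (forall c, L (fun=> c)) /\
  (forall a l l', L l -> L l' -> L (fun e => a * l e + l' e)).

(** The algebra generated by affine forms [l] in [L], by indicators of affine
    inequalities (the pieces) and by indicators of affine divisibility conditions
    (the periodic part). *)
Inductive piecewise_qp (R : realType) (E : Type) (L : (E -> int) -> Prop) :
    (E -> R) -> Prop :=
| Pqp_cst c : piecewise_qp L (fun=> c)
| Pqp_lin l : L l -> piecewise_qp L (fun e => (l e)%:~R)
| Pqp_ge0 l : L l -> piecewise_qp L (fun e => (0 <= l e)%R%:R)
| Pqp_dvd (M : nat) l : (0 < M)%N -> L l ->
    piecewise_qp L (fun e => (M%:Z %| l e)%Z%:R)
| Pqp_add f g : piecewise_qp L f -> piecewise_qp L g ->
    piecewise_qp L (fun e => f e + g e)
| Pqp_mul f g : piecewise_qp L f -> piecewise_qp L g ->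
    piecewise_qp L (fun e => f e * g e).

Definition affine_ext (E : Type) (L : (E -> int) -> Prop) :
    (int * E -> int) -> Prop :=
  fun g => exists a l, L l /\ g = (fun p => a * p.1 + l p.2).

Section PiecewiseQuasiPoly.
Variables (R : realType) (E : Type) (L : (E -> int) -> Prop).
Hypothesis affL : affine_closed L.
Notation pqp := (@piecewise_qp R E L).

Lemma eq_pqp f g : f =1 g -> pqp f -> pqp g.
Proof. by move=> /funext ->. Qed.

Lemma pqp_subst (E' : Type) (L' : (E' -> int) -> Prop) (h : E' -> E) (f : E -> R) :
  (forall l, L l -> L' (fun e => l (h e))) ->
  pqp f -> piecewise_qp L' (fun e => f (h e)).
Proof.
move=> hL; elim=> {f}[c|l Ll|l Ll|M l M0 Ll|f g _ IHf _ IHg|f g _ IHf _ IHg].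
- exact: Pqp_cst.
- exact: (Pqp_lin _ (hL _ Ll)).
- exact: (Pqp_ge0 _ (hL _ Ll)).
- exact: (Pqp_dvd _ M0 (hL _ Ll)).
- exact: Pqp_add.
- exact: Pqp_mul.
Qed.

Lemma affine_cst c : L (fun=> c). Proof. exact: affL.1. Qed.

Lemma affine_lincomb a b c l l' :
  L l -> L l' -> L (fun e => a * l e + b * l' e + c).
Proof.
move=> Ll Ll'.
have := affL.2 a _ _ Ll (affL.2 b _ _ Ll' (affine_cst c)).
by congr (L _); apply/funext => e; rewrite addrA.
Qed.

Lemma affine_scale a c l : L l -> L (fun e => a * l e + c).
Proof. by move=> Ll; apply: affL.2 => //; exact: affine_cst. Qed.

Lemma pqpB f g : pqp f -> pqp g -> pqp (fun e => f e - g e).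
Proof.
move=> pf pg; apply: eq_pqp (Pqp_add pf (Pqp_mul (Pqp_cst L (-1)) pg)) => e.
by rewrite mulN1r.
Qed.

Lemma pqp_sum (I : Type) (s : seq I) (f : I -> E -> R) :
  (forall i, pqp (f i)) -> pqp (fun e => \sum_(i <- s) f i e).
Proof.
move=> pf; elim: s => [|i s IH].
  by apply: eq_pqp (Pqp_cst L 0) => e; rewrite big_nil.
by apply: eq_pqp (Pqp_add (pf i) IH) => e; rewrite big_cons.
Qed.

Lemma pqp_prod (I : Type) (s : seq I) (f : I -> E -> R) :
  (forall i, pqp (f i)) -> pqp (fun e => \prod_(i <- s) f i e).
Proof.
move=> pf; elim: s => [|i s IH].
  by apply: eq_pqp (Pqp_cst L 1) => e; rewrite big_nil.
by apply: eq_pqp (Pqp_mul (pf i) IH) => e; rewrite big_cons.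
Qed.

Lemma pqp_horner (p : {poly R}) f : pqp f -> pqp (fun e => p.[f e]).
Proof.
move=> pf; have pm (i : 'I_(size p)) :
    pqp (fun e => p`_i * \prod_(j <- iota 0 i) f e).
  by apply: Pqp_mul; [exact: Pqp_cst | exact: pqp_prod].
apply: eq_pqp (pqp_sum (index_enum 'I_(size p)) pm) => e.
rewrite horner_coef; apply: eq_bigr => i _.
by rewrite big_const_seq count_predT size_iota iter_mulr_1.
Qed.

(** Splitting by the residue of [l e] modulo the period, [phi (l e)] is on each
    class a polynomial in an affine form. *)
Lemma pqp_quasi_poly (phi : int -> R) l :
  quasi_poly phi -> L l -> pqp (fun e => phi (l e)).
Proof.
move=> [M M0 HM] Ll; have [p pP] := choice HM.
have MZ0 : M%:Z != 0 by rewrite eqz_nat -lt0n.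
have MR0 : M%:R != 0 :> R by rewrite pnatr_eq0 -lt0n.
have pr (i : 'I_M) : pqp (fun e => (M%:Z %| 1 * l e + - i%:Z)%Z%:R *
    (p i%:Z).[M%:R^-1 * (1 * l e + - i%:Z)%:~R]).
  have Li := affine_scale 1 (- i%:Z) Ll; apply: Pqp_mul; first exact: Pqp_dvd.
  by apply: pqp_horner; apply: Pqp_mul; [exact: Pqp_cst | exact: Pqp_lin].
apply: eq_pqp (pqp_sum (index_enum 'I_M) pr) => e.
rewrite (sum_residues (l e) (fun r => (p r%:Z).[M%:R^-1 * (1 * l e + - r%:Z)%:~R])) //.
set t := (l e %/ M%:Z)%Z; have rE : `|(l e %% M%:Z)%Z|%N%:Z = (l e %% M%:Z)%Z.
  by rewrite gez0_abs ?modz_ge0.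
have lE : l e - (l e %% M%:Z)%Z = t * M%:Z by rewrite {1}(divz_eq (l e) M%:Z) addrK.
rewrite mul1r rE lE intrM mulrC mulfK //.
by rewrite -pP -divz_eq.
Qed.

End PiecewiseQuasiPoly.

(** * Summation over an integer variable *)

(** A negative integer stands for the empty range of summation. *)
Definition nat_part (z : int) : nat := if z is Posz n then n else 0%N.

(** Normal form of a piecewise quasi-polynomial in a distinguished variable [x]:
    sums of terms in which [x] occurs only in a quasi-polynomial [phi x] and in at
    most one lower bound [0 <= a * x + l] with [0 < a]. Such a term can be summed
    over [x] with an antidifference of [phi]. *)
Inductive cut_form (R : realType) (E : Type) (L : (E -> int) -> Prop) :
    (int * E -> R) -> Prop :=
| Cut_none q phi : piecewise_qp L q -> quasi_poly phi ->
    cut_form L (fun p => q p.2 * phi p.1)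
| Cut_ge q phi (a : nat) l : piecewise_qp L q -> quasi_poly phi ->
    (0 < a)%N -> L l ->
    cut_form L (fun p => q p.2 * phi p.1 * (0 <= a%:Z * p.1 + l p.2)%R%:R)
| Cut_add f g : cut_form L f -> cut_form L g -> cut_form L (fun p => f p + g p).

Section Summation.
Variables (R : realType) (E : Type) (L : (E -> int) -> Prop).
Hypothesis affL : affine_closed L.
Notation pqp := (@piecewise_qp R E L).
Notation cuts := (@cut_form R E L).

Lemma eq_cut f g : f =1 g -> cuts f -> cuts g.
Proof. by move=> /funext ->. Qed.

Lemma cut_sum (I : Type) (s : seq I) (f : I -> int * E -> R) :
  (forall i, cuts (f i)) -> cuts (fun e => \sum_(i <- s) f i e).
Proof.
move=> pf; elim: s => [|i s IH].
  apply: eq_cut (Cut_none (Pqp_cst L 0) (quasi_poly_cst 0)) => e.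
  by rewrite big_nil mul0r.
by apply: eq_cut (Cut_add (pf i) IH) => e; rewrite big_cons.
Qed.

(** Of two lower bounds on [x] the larger one implies the other, and which of them
    is larger is an affine inequality in the remaining variables; so a product of
    two cuts is a combination of single cuts. *)
Lemma cutM f g : cuts f -> cuts g -> cuts (fun p => f p * g p).
Proof.
move=> cf cg.
elim: cf => {f}[q phi Hq Hphi|q phi a l Hq Hphi a0 Ll|f f' _ IHf _ IHf'].
- elim: cg => {g}[q' phi' Hq' Hphi'|q' phi' a l Hq' Hphi' a0 Ll|g g' _ IHg _ IHg'].
  + apply: eq_cut (Cut_none (Pqp_mul Hq Hq') (quasi_polyM Hphi Hphi')) => p.
    ring.
  + apply: eq_cut (Cut_ge (Pqp_mul Hq Hq') (quasi_polyM Hphi Hphi') a0 Ll) => p.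
    ring.
  + by apply: eq_cut (Cut_add IHg IHg') => p; rewrite mulrDr.
- elim: cg => {g}[q' phi' Hq' Hphi'|q' phi' a' l' Hq' Hphi' a'0 Ll'|g g' _ IHg _ IHg'].
  + apply: eq_cut (Cut_ge (Pqp_mul Hq Hq') (quasi_polyM Hphi Hphi') a0 Ll) => p.
    ring.
  + pose c e : R := (0 <= a%:Z * l' e + - a'%:Z * l e + 0)%R%:R.
    have Hc : pqp c by apply: Pqp_ge0; exact: affine_lincomb.
    have Hc' : pqp (fun e => 1 - c e) by apply: pqpB => //; exact: Pqp_cst.
    have Hqq := Pqp_mul Hq Hq'; have Hpp := quasi_polyM Hphi Hphi'.
    apply: eq_cut (Cut_add (Cut_ge (Pqp_mul Hqq Hc) Hpp a0 Ll)
                           (Cut_ge (Pqp_mul Hqq Hc') Hpp a'0 Ll')) => -[x e] /=.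
    rewrite /c addr0 mulNr.
    have [cc|cc] := leP 0 (a%:Z * l' e - a'%:Z * l e).
      have [ax|ax] := leP 0 (a%:Z * x + l e); last by rewrite /= ?mulr1n ?mulr0n; ring.
      have -> : 0 <= a'%:Z * x + l' e.
        rewrite -(pmulr_rge0 _ (_ : 0 < a%:Z)) ?ltz_nat //; nia.
      rewrite /= ?mulr1n ?mulr0n; ring.
    have [ax|ax] := leP 0 (a'%:Z * x + l' e); last by rewrite /= ?mulr1n ?mulr0n; ring.
    have -> : 0 <= a%:Z * x + l e.
      rewrite -(pmulr_rge0 _ (_ : 0 < a'%:Z)) ?ltz_nat //; nia.
    rewrite /= ?mulr1n ?mulr0n; ring.
  + by apply: eq_cut (Cut_add IHg IHg') => p; rewrite mulrDr.
- by apply: eq_cut (Cut_add IHf IHf') => p; rewrite mulrDl.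
Qed.

(** An upper bound on [x] is the complement of a lower bound, and a congruence on
    [a * x + l] splits by the residue of [l] into congruences on [x] alone. *)
Lemma pqp_cut f : piecewise_qp (affine_ext L) f -> cuts f.
Proof.
elim=> {f}[c|_ [a [l [Ll ->]]]|_ [a [l [Ll ->]]]|M _ M0 [a [l [Ll ->]]]
          |f g _ IHf _ IHg|f g _ IHf _ IHg].
- apply: eq_cut (Cut_none (Pqp_cst L c) (quasi_poly_cst 1)) => p.
  by rewrite mulr1.
- apply: eq_cut (Cut_add (Cut_none (Pqp_cst L a%:~R) (quasi_poly_id R))
                         (Cut_none (Pqp_lin R Ll) (quasi_poly_cst 1))) => p.
  by rewrite mulr1 intrD intrM.
- have [a0|a0] := leP 0 a.
    case: a a0 => // -[_|a _].
      apply: eq_cut (Cut_none (Pqp_ge0 R Ll) (quasi_poly_cst 1)) => p.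
      by rewrite mulr1 mul0r add0r.
    apply: eq_cut (Cut_ge (Pqp_cst L 1) (quasi_poly_cst 1) (ltn0Sn a) Ll) => p.
    by rewrite !mul1r.
  case: a a0 => // a _.
  have Ll1 := affine_scale affL (-1) (-1) Ll.
  apply: eq_cut (Cut_add (Cut_none (Pqp_cst L 1) (quasi_poly_cst 1))
    (Cut_ge (Pqp_cst L (-1)) (quasi_poly_cst 1) (ltn0Sn a) Ll1)) => p.
  rewrite !mulr1 NegzE.
  have -> : (0 <= a.+1%:Z * p.1 + (-1 * l p.2 + -1)) =
     ~~ (0 <= - a.+1%:Z * p.1 + l p.2) by lia.
  by case: (0 <= _); rewrite /= ?mulr1n ?mulr0n; ring.
- have cr (r : 'I_M) := Cut_none
    (Pqp_dvd R M0 (affine_scale affL 1 (- r%:Z) Ll))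
    (quasi_poly_dvd R a r%:Z M0).
  apply: eq_cut (cut_sum (index_enum 'I_M) cr) => -[x e] /=.
  rewrite (sum_residues (l e) (fun r => (M%:Z %| a * x + r%:Z)%Z%:R)) //.
  rewrite gez0_abs ?modz_ge0 ?eqz_nat -?lt0n //.
  have -> : a * x + l e = (l e %/ M%:Z)%Z * M%:Z + (a * x + (l e %% M%:Z)%Z).
    by rewrite {1}(divz_eq (l e) M%:Z) addrCA.
  by rewrite [in RHS]rpredDl ?dvdz_mull.
- exact: Cut_add.
- exact: cutM.
Qed.

Lemma telescope_from (phi Phi : int -> R) (t : int) (n : nat) : 0 <= t ->
  (forall x, Phi (x + 1) = Phi x + phi x) ->
  \sum_(x < n) phi x%:Z * (t <= x%:Z)%R%:R = (t <= n%:Z)%R%:R * (Phi n%:Z - Phi t).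
Proof.
move=> t0 PhiS; elim: n => [|n IH].
  rewrite big_ord0; case: (leP t 0) => t0'; last by rewrite mul0r.
  by have -> : t = 0 by [lia]; rewrite subrr mulr0.
rewrite big_ord_recr /= IH.
have -> : Phi n.+1%:Z = Phi n%:Z + phi n%:Z by rewrite -PhiS; congr Phi; lia.
have [tn|tn] := leP t n%:Z; first by have -> : t <= n.+1%:Z by [lia]; rewrite /= ?mulr1n; ring.
case: (leP t n.+1%:Z) => tn1; last by rewrite /= ?mulr1n ?mulr0n; ring.
have -> : t = n%:Z + 1 by lia.
by rewrite PhiS subrr; ring.
Qed.

(** With the lower bound [t], the sum of [phi] over [0 <= x < n] telescopes to
    [Phi n] if [t <= 0] and to [Phi n - Phi t] if [0 < t <= n]; the bound [t] is a
    ceiling of an affine form, so [Phi t] is again a piecewise quasi-polynomial. *)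
Lemma pqp_sum_cut f u : cuts f -> L u ->
  pqp (fun e => \sum_(x < nat_part (u e)) f (x%:Z, e)).
Proof.
move=> cf Lu; elim: cf => {f}[q phi Hq Hphi|q phi a l Hq Hphi a0 Ll|f g _ IHf _ IHg].
- have [Phi [HPhi Phi0 PhiS]] := quasi_poly_antidifference Hphi.
  apply: eq_pqp (Pqp_mul Hq (Pqp_mul (Pqp_ge0 R Lu)
    (pqp_quasi_poly affL HPhi Lu))) => e /=.
  rewrite -mulr_sumr; congr (_ * _).
  case: (u e) => n; last by rewrite /= mul0r big_ord0.
  rewrite le0z_nat mul1r /=.
  have := telescope_from n (lexx 0) PhiS; rewrite Phi0 subr0 le0z_nat mul1r.
  by move=> <-; apply: eq_bigr => i _; rewrite le0z_nat mulr1.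
- have [Phi [HPhi Phi0 PhiS]] := quasi_poly_antidifference Hphi.
  pose k e : R := (0 <= l e)%R%:R.
  have Hk : pqp k by exact: Pqp_ge0.
  have Hk' : pqp (fun e => 1 - k e) by apply: pqpB => //; exact: Pqp_cst.
  have HPu := pqp_quasi_poly affL HPhi Lu.
  have HPt := pqp_quasi_poly affL (quasi_poly_ceil a0 HPhi) Ll.
  have Hau := Pqp_ge0 R (affine_lincomb affL a%:Z 1 0 Lu Ll).
  apply: eq_pqp (Pqp_mul Hq (Pqp_mul (Pqp_ge0 R Lu)
    (Pqp_add (Pqp_mul Hk HPu)
       (Pqp_mul Hk' (Pqp_mul Hau (pqpB HPu HPt)))))) => e /=.
  under [RHS]eq_bigr do rewrite -mulrA.
  rewrite -mulr_sumr; congr (_ * _).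
  case: (u e) => n; last by rewrite /= mul0r big_ord0.
  rewrite le0z_nat mul1r /k mul1r addr0 /=.
  have aZ0 : 0 < a%:Z by rewrite ltz_nat.
  pose t := - (l e %/ a%:Z)%Z.
  have tP (x : int) : (0 <= a%:Z * x + l e) = (t <= x).
    rewrite /t lerNl.
    have := divz_eq (l e) a%:Z; have := ltz_pmod (l e) aZ0.
    have := modz_ge0 (l e) (lt0r_neq0 aZ0).
    move: (l e %/ a%:Z)%Z (l e %% a%:Z)%Z => c r r0 ra ->.
    by apply/idP/idP; nia.
  rewrite tP; under eq_bigr do rewrite tP; rewrite -/t.
  have := tP 0; rewrite mulr0 add0r => ->.
  have [t0|t0] := leP t 0; last first.
    by rewrite (telescope_from _ (ltW t0) PhiS) mulr0n; ring.
  rewrite subrr mul0r addr0 mul1r.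
  have := telescope_from n (lexx 0) PhiS; rewrite Phi0 subr0 le0z_nat mul1r.
  move=> <-; apply: eq_bigr => i _; rewrite le0z_nat.
  by rewrite (le_trans t0).
- by apply: eq_pqp (Pqp_add IHf IHg) => e; rewrite big_split.
Qed.

(** This is what allows a lattice-point count to be built up one coordinate at a
    time. *)
Lemma pqp_partial_sum f u : piecewise_qp (affine_ext L) f -> L u ->
  pqp (fun e => \sum_(x < nat_part (u e)) f (x%:Z, e)).
Proof. by move=> /pqp_cut; exact: pqp_sum_cut. Qed.

End Summation.

(** * Restriction to rays *)

Definition affine_form (m : nat) : ('rV[int]_m -> int) -> Prop :=
  fun l => exists (a : 'I_m -> int) (c : int),
    l = (fun e => \sum_j a j * e 0 j + c).

Lemma affine_form_closed m : affine_closed (@affine_form m).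
Proof.
split=> [c|b _ _ [a1 [c1 ->]] [a2 [c2 ->]]].
  by exists (fun=> 0), c; apply/funext => e; rewrite big1 ?add0r // => j; rewrite mul0r.
exists (fun j => b * a1 j + a2 j), (b * c1 + c2); apply/funext => e.
rewrite mulrDr mulr_sumr addrACA -big_split; congr (_ + _).
by apply: eq_bigr => j _; rewrite mulrDl mulrA.
Qed.

Lemma affine_form_coord m (j : 'I_m) (c : int) : affine_form (fun e => c * e 0 j).
Proof.
exists (fun i => if i == j then c else 0), 0; apply/funext => e.
rewrite addr0 (bigD1 j) //= eqxx big1 ?addr0 // => i /negbTE ->; exact: mul0r.
Qed.

(** Along a ray every inequality is eventually decided, by the sign of the slope
    or, if the slope vanishes, by the constant. *)
Lemma affine_eventually (R : realType) (A c : R) :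
  exists (K : nat) (s : bool), forall x, K%:R <= x -> (0 <= A * x + c) = s.
Proof.
have [A0|A0|A0] := ltgtP A 0.
- exists (Num.bound (`|c| / - A)), false => x Kx; apply/negbTE; rewrite -ltNge.
  have : `|c| / - A < x by apply: lt_le_trans Kx; apply: archi_boundP;
    rewrite divr_ge0 // oppr_ge0 ltW.
  by rewrite ltr_pdivrMr ?oppr_gt0 // => h; have := ler_norm c; nra.
- exists (Num.bound (`|c| / A)), true => x Kx; apply/idP.
  have : `|c| / A < x by apply: lt_le_trans Kx; apply: archi_boundP;
    rewrite divr_ge0 // ltW.
  by rewrite ltr_pdivrMr // => h; have := ler_norm (- c); rewrite normrN; nra.
- by exists 0%N, (0 <= c) => x _; rewrite A0 mul0r add0r.
Qed.

(** Restricted to an arithmetic progression of integer points [N w] on a ray, a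
    piecewise quasi-polynomial is eventually a polynomial in [N]: inequalities are
    eventually constant, congruences are constant along multiples of the moduli,
    and an affine form is [(\sum_j a j * w j) * N + b]. The point is the uniformity:
    the coefficients are bounded in terms of a bound on the slopes [w], whereas the
    steps [M], [K] and the polynomial may depend on the ray. *)
Lemma pqp_along_ray (R : realType) (m : nat) (f : 'rV[int]_m -> R) (Lam : R) :
  piecewise_qp (@affine_form m) f ->
  exists c : nat -> R, forall (w : 'I_m -> R) (n0 T : nat) (e0 dir : 'rV[int]_m),
    (0 < T)%N -> (forall j, `|w j| <= Lam) ->
    (forall j, (e0 0 j)%:~R = n0%:R * w j) ->
    (forall j, (dir 0 j)%:~R = T%:R * w j) ->
  exists (M K : nat) (p : {poly R}), [/\ (0 < M)%N, forall i, `|p`_i| <= c i &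
    forall k, (M %| k)%N -> (K <= k)%N ->
      f (e0 + dir *+ k) = p.[(n0 + k * T)%N%:R]].
Proof.
have formE a c w n0 T (e0 dir : 'rV[int]_m) k :
    (forall j, (e0 0 j)%:~R = n0%:R * w j :> R) ->
    (forall j, (dir 0 j)%:~R = T%:R * w j) ->
  (\sum_j a j * (e0 + dir *+ k) 0 j + c)%:~R =
    (\sum_j (a j)%:~R * w j) * (n0 + k * T)%N%:R + c%:~R :> R.
  move=> e0E dirE; rewrite intrD; congr (_ + _).
  rewrite rmorph_sum mulr_suml; apply: eq_bigr => j _.
  rewrite /= mxE mulmxnE intrM intrD e0E.
  rewrite -[dir 0 j *+ k]mulr_natl natz intrM dirE -pmulrn natrD natrM; ring.
elim=> {f}[b|_ [a [b ->]]|_ [a [b ->]]|M _ M0 [a [b ->]]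
          |f g _ [cf IHf] _ [cg IHg]|f g _ [cf IHf] _ [cg IHg]].
- exists (fun=> `|b|) => *; exists 1%N, 0%N, b%:P; split=> // [i|k _ _].
    by rewrite coefC; case: eqP; rewrite ?normr0.
  by rewrite hornerC.
- exists (fun=> \sum_j `|(a j)%:~R| * Lam + `|b%:~R|) => w n0 T e0 dir T0 wL e0E dirE.
  have AL : `|\sum_j (a j)%:~R * w j| <= \sum_j `|(a j)%:~R| * Lam.
    apply: le_trans (ler_norm_sum _ _ _) _; apply: ler_sum => j _.
    by rewrite normrM ler_wpM2l.
  exists 1%N, 0%N, ((\sum_j (a j)%:~R * w j) *: 'X + b%:~R%:P); split=> // [i|k _ _].
    rewrite coefD coefZ coefX coefC.
    have := normr_ge0 (\sum_j (a j)%:~R * w j); have := normr_ge0 (b%:~R : R).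
    by case: i => [|[|i]] /=; rewrite ?mulr0 ?add0r ?mulr1 ?addr0 ?normr0; lra.
  by rewrite (formE _ _ _ _ _ _ _ _ e0E dirE) !hornerE.
- exists (fun=> 1) => w n0 T e0 dir T0 wL e0E dirE.
  have [K [s sP]] := affine_eventually (\sum_j (a j)%:~R * w j) b%:~R.
  exists 1%N, K, (s%:R)%:P; split=> // [i|k _ Kk].
    by rewrite coefC; case: eqP; case: s {sP} => _; rewrite ?normr0 ?normr1.
  rewrite hornerC -(ler0z R) (formE _ _ _ _ _ _ _ _ e0E dirE) sP // ler_nat.
  by apply: leq_trans Kk _; rewrite (leq_trans _ (leq_addl _ _)) // leq_pmulr.
- exists (fun=> 1) => w n0 T e0 dir T0 wL e0E dirE.
  pose s := (M%:Z %| \sum_j a j * e0 0 j + b)%Z.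
  exists M, 0%N, (s%:R)%:P; split=> // [i|k Mk _].
    by rewrite coefC; case: eqP; case: s => _; rewrite ?normr0 ?normr1.
  have -> : \sum_j a j * (e0 + dir *+ k) 0 j + b =
      (\sum_j a j * dir 0 j) * k%:Z + (\sum_j a j * e0 0 j + b).
    rewrite addrA; congr (_ + _); rewrite mulr_suml -big_split.
    apply: eq_bigr => j _; rewrite mxE mulmxnE -mulr_natr natz /=; ring.
  by rewrite hornerC /s [in LHS]rpredDl ?dvdz_mull.
- exists (fun i => cf i + cg i) => w n0 T e0 dir T0 wL e0E dirE.
  have [M [K [p [M0 pc pE]]]] := IHf _ _ _ _ _ T0 wL e0E dirE.
  have [N [J [q [N0 qc qE]]]] := IHg _ _ _ _ _ T0 wL e0E dirE.
  exists (M * N)%N, (maxn K J), (p + q); split=> [|i|k MNk].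
  + by rewrite muln_gt0 M0.
  + by rewrite coefD (le_trans (ler_normD _ _)) // lerD.
  + rewrite geq_max => /andP[Kk Jk]; rewrite hornerD pE ?qE //.
      exact: dvdn_trans (dvdn_mull _ _) MNk.
    exact: dvdn_trans (dvdn_mulr _ _) MNk.
- exists (fun i => \sum_(j < i.+1) cf j * cg (i - j)%N) => w n0 T e0 dir T0 wL e0E dirE.
  have [M [K [p [M0 pc pE]]]] := IHf _ _ _ _ _ T0 wL e0E dirE.
  have [N [J [q [N0 qc qE]]]] := IHg _ _ _ _ _ T0 wL e0E dirE.
  exists (M * N)%N, (maxn K J), (p * q); split=> [|i|k MNk].
  + by rewrite muln_gt0 M0.
  + rewrite coefM (le_trans (ler_norm_sum _ _ _)) //; apply: ler_sum => j _.
    by rewrite normrM ler_pM.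
  + rewrite geq_max => /andP[Kk Jk]; rewrite hornerM pE ?qE //.
      exact: dvdn_trans (dvdn_mull _ _) MNk.
    exact: dvdn_trans (dvdn_mulr _ _) MNk.
Qed.

(** * Sums over boxes *)

Definition set_coord (m : nat) (e : 'rV[int]_m) (i : 'I_m) (x : int) : 'rV[int]_m :=
  \row_j (if j == i then x else e 0 j).

Fixpoint box_points (m : nat) (b : 'rV[int]_m -> int) (s : seq 'I_m)
    (e : 'rV[int]_m) : seq 'rV[int]_m :=
  if s is i :: s' then
    [seq e' | x <- iota 0 (nat_part (2 * b e)),
              e' <- box_points b s' (set_coord e i (x%:Z - b e))]
  else [:: e].

(** One application of [pqp_partial_sum] for each coordinate: the substitution
    [x - b e] for the coordinate [i] keeps forms affine. *)
Lemma pqp_box_sum (R : realType) (m : nat) (b : 'rV[int]_m -> int)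
    (s : seq 'I_m) (f : 'rV[int]_m -> R) :
  affine_form b -> piecewise_qp (@affine_form m) f ->
  piecewise_qp (@affine_form m) (fun e => \sum_(e' <- box_points b s e) f e').
Proof.
move=> Lb pf; have Lc := affine_form_closed m.
elim: s => [|i s IH] /=.
  by apply: eq_pqp pf => e; rewrite big_seq1.
pose h (p : int * 'rV[int]_m) := set_coord p.2 i (p.1 - b p.2).
have hL l : affine_form l -> affine_ext (@affine_form m) (fun p => l (h p)).
  move=> [a [c lE]]; exists (a i), (fun e : 'rV[int]_m => - a i * (1 * e 0 i) + (- a i * b e + l e)).
  split.
    apply: Lc.2; first exact: affine_form_coord.
    by apply: Lc.2 => //; exists a, c.
  apply/funext => -[x e]; rewrite lE /h /set_coord /= (bigD1 i) //= mxE eqxx.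
  rewrite [in RHS](bigD1 i) //= (eq_bigr (fun j => a j * e 0 j)); first ring.
  by move=> j /negbTE ji; rewrite mxE ji.
apply: eq_pqp (pqp_partial_sum Lc (pqp_subst hL IH) (affine_scale Lc 2 0 Lb)) => e.
rewrite big_allpairs_dep addr0 /h /=.
by rewrite -[in RHS](subn0 (nat_part _)) (big_mkord xpredT).
Qed.

Lemma mem_box_points (m : nat) (b : 'rV[int]_m -> int) (s : seq 'I_m)
    (e e' : 'rV[int]_m) :
  uniq s -> (forall i x e, i \in s -> b (set_coord e i x) = b e) ->
  e' \in box_points b s e <->
  (forall j, j \notin s -> e' 0 j = e 0 j) /\
  (forall j, j \in s -> - b e <= e' 0 j < b e).
Proof.
elim: s e => [|i s IH] e /=.
  move=> _ _; rewrite inE; split=> [/eqP -> //|[ee _]].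
  by apply/eqP/rowP => j; exact: ee.
move=> /andP[iNs us] bset; have bset' i' x e1 : i' \in s -> _ := fun is' =>
  bset i' x e1 (mem_behead (s := i :: s) is').
split.
  move=> /allpairsPdep[x [y [+ + e'y]]]; rewrite -{y}e'y mem_iota add0n => xr.
  move=> /(IH _ us bset')[yNs ys]; split=> j.
    rewrite inE negb_or => /andP[ji js].
    by rewrite yNs // mxE (negbTE ji).
  rewrite inE => /orP[/eqP ->|js]; last first.
    by have := ys _ js; rewrite bset // mem_head.
  rewrite yNs // mxE eqxx; move: xr; case E: (2 * b e) => [n|n] //= xn; lia.
move=> [eNs es]; apply/allpairsPdep.
have := es i (mem_head _ _) => /andP[ei1 ei2].
exists (absz (e' 0 i + b e)), e'; split=> //.
  rewrite mem_iota add0n; case E: (2 * b e) => [n|n] /=; lia.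
apply/(IH _ us bset'); rewrite gez0_abs ?addrK; last by lia.
split=> j.
  move=> js; rewrite mxE; case: eqP => [-> //|/eqP ji].
  by rewrite eNs // inE negb_or ji.
by move=> js; rewrite bset ?mem_head // es // inE js orbT.
Qed.

Lemma uniq_box_points (m : nat) (b : 'rV[int]_m -> int) (s : seq 'I_m)
    (e : 'rV[int]_m) :
  uniq s -> (forall i x e, i \in s -> b (set_coord e i x) = b e) ->
  uniq (box_points b s e).
Proof.
elim: s e => [|i s IH] e //= /andP[iNs us] bset.
have bset' i' x e1 : i' \in s -> _ := fun is' =>
  bset i' x e1 (mem_behead (s := i :: s) is').
apply: allpairs_uniq_dep; first exact: iota_uniq.
  by move=> x _; exact: IH.
move=> [x y] [x' y'] /allpairsPdep[x1 [y1 [_ + ->]]] /allpairsPdep[x2 [y2 [_ + ->]]] /=.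
move=> /(mem_box_points _ _ us bset')[h1 _] /(mem_box_points _ _ us bset')[h2 _] y12.
rewrite -y12 in h2 *.
have := h2 i iNs; rewrite h1 // !mxE eqxx => /addIr [->] //.
Qed.

(** * Inequalities for the dilates of a rational polytope *)

Definition int_vec (R : realType) (m : nat) (v : 'rV[int]_m) : 'rV[R]_m :=
  map_mx intr v.

Definition dot (R : realType) (m : nat) (l : 'rV[int]_m) (x : 'rV[R]_m) : R :=
  \sum_j (l 0 j)%:~R * x 0 j.

Fixpoint in_cone (R : realType) (m : nat) (V : seq 'rV[int]_m) (x : 'rV[R]_m) : Prop :=
  if V is v :: V' then
    exists w : R, 0 <= w /\ in_cone V' (x - w *: int_vec R v)
  else x = 0.

Section Cone.
Variables (R : realType) (m : nat).
Implicit Types (x y : 'rV[R]_m) (l v : 'rV[int]_m).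

Lemma dotDr l x y : dot l (x + y) = dot l x + dot l y.
Proof. by rewrite -big_split; apply: eq_bigr => j _; rewrite mxE mulrDr. Qed.

Lemma dotZr l a x : dot l (a *: x) = a * dot l x.
Proof. by rewrite mulr_sumr; apply: eq_bigr => j _; rewrite mxE mulrCA. Qed.

Lemma dot_lincombl a b l l' x :
  dot (a *: l + b *: l') x = a%:~R * dot l x + b%:~R * dot l' x.
Proof.
rewrite !mulr_sumr -big_split; apply: eq_bigr => j _.
by rewrite !mxE intrD !intrM /=; ring.
Qed.

Lemma dot_int_vec l v : dot l (int_vec R v) = (\sum_j l 0 j * v 0 j)%:~R.
Proof.
by rewrite rmorph_sum; apply: eq_bigr => j _; rewrite mxE /= intrM.
Qed.

Lemma seq_least_upper_bound (T : eqType) (s : seq T) (f : T -> R) :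
  exists w, [/\ 0 <= w, forall q, q \in s -> f q <= w &
    forall u, 0 <= u -> (forall q, q \in s -> f q <= u) -> w <= u].
Proof.
elim: s => [|p s [w [w0 sw ws]]]; first by exists 0; split.
exists (Num.max (f p) w); split; first by rewrite le_max w0 orbT.
  move=> q; rewrite inE => /orP[/eqP->|/sw qw]; first by rewrite le_max lexx.
  by rewrite le_max qw orbT.
move=> u u0 su; rewrite ge_max su ?mem_head //= ws // => q qs.
by rewrite su // inE qs orbT.
Qed.

(** Finitely generated cones are polyhedral, by adding one generator at a time:
    [x] lies in the cone of [v] and [V] if and only if some [w >= 0] satisfies
    [w * dot l v <= dot l x] for all the inequalities [l] of the cone of [V], and
    [w] is eliminated by comparing every lower bound on it with every upper bound. *)
Lemma cone_finite_inequalities (V : seq 'rV[int]_m) :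
  exists F : seq 'rV[int]_m, forall x,
    in_cone V x <-> forall l, l \in F -> 0 <= dot l x.
Proof.
elim: V => [|v V [F FP]] /=.
  exists ([seq delta_mx 0 j | j <- enum 'I_m] ++
          [seq - delta_mx 0 j | j <- enum 'I_m]) => x; split=> [->|xF].
    by move=> l _; rewrite /dot big1 // => j _; rewrite mxE mulr0.
  have dotj j : dot (delta_mx 0 j) x = x 0 j.
    rewrite /dot (bigD1 j) //= mxE !eqxx mul1r big1 ?addr0 // => i ij.
    by rewrite mxE (negbTE ij) mul0r.
  have dotNj j : dot (- delta_mx 0 j) x = - x 0 j.
    rewrite -dotj /dot -sumrN; apply: eq_bigr => i _.
    by rewrite mxE intrN mulNr.
  apply/rowP => j; rewrite mxE; apply/eqP; rewrite eq_le -oppr_ge0 -dotNj -dotj.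
  apply/andP; split; apply: xF; rewrite mem_cat; apply/orP; [right|left];
    by apply/mapP; exists j; rewrite // mem_enum.
pose lv l : int := \sum_j l 0 j * v 0 j.
exists ([seq l <- F | 0 <= lv l] ++
  [seq (- lv q) *: p + lv p *: q | p <- [seq l <- F | 0 < lv l],
                                   q <- [seq l <- F | lv l < 0]]) => x.
have dE w l : dot l (x - w *: int_vec R v) = dot l x - w * (lv l)%:~R.
  by rewrite -scaleNr dotDr dotZr dot_int_vec mulNr.
split=> [[w [w0 /FP xF]] l|xF].
  rewrite mem_cat => /orP[|/allpairsP[[p q] /= [+ + ->]]].
    rewrite mem_filter => /andP[l0 /xF]; rewrite dE subr_ge0; apply: le_trans.
    by rewrite mulr_ge0 // ler0z.
  rewrite !mem_filter => /andP[p0 /xF]; rewrite dE => px /andP[q0 /xF]; rewrite dE => qx.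
  rewrite dot_lincombl intrN.
  have p0' : 0 < (lv p)%:~R :> R by rewrite ltr0z.
  have q0' : (lv q)%:~R < 0 :> R by rewrite ltrz0.
  nra.
have [w [w0 wl wu]] := seq_least_upper_bound [seq l <- F | lv l < 0]
  (fun l => dot l x / (lv l)%:~R).
exists w; split=> //; apply/FP => l lF; rewrite dE subr_ge0.
have [l0|l0|l0] := ltgtP (lv l) 0.
- have := wl l; rewrite mem_filter l0 lF => /(_ isT).
  by rewrite ler_ndivrMr ?ltrz0.
- rewrite -ler_pdivlMr ?ltr0z //; apply: wu.
    rewrite divr_ge0 ?ler0z ?(ltW l0) // xF // mem_cat mem_filter lF.
    by rewrite (ltW l0).
  move=> q; rewrite mem_filter => /andP[q0 qF].
  have : 0 <= dot ((- lv q) *: l + lv l *: q) x.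
    apply: xF; rewrite mem_cat; apply/orP; right; apply/allpairsP.
    by exists (l, q); rewrite !mem_filter l0 lF q0 qF.
  rewrite dot_lincombl intrN ler_ndivrMr ?ltrz0 // mulrAC ler_pdivrMr ?ltr0z //.
  by rewrite mulNr addrC subr_ge0; rewrite [_ * dot q x]mulrC [_ * dot l x]mulrC.
- rewrite l0 mulr0 xF // mem_cat mem_filter l0 lF //.
Qed.

Lemma in_coneP (I : eqType) (s : seq I) (u : I -> 'rV[int]_m) x : uniq s ->
  in_cone [seq u i | i <- s] x <->
  exists c : I -> R, (forall i, 0 <= c i) /\ x = \sum_(i <- s) c i *: int_vec R (u i).
Proof.
elim: s x => [|i s IH] x /=.
  by move=> _; split=> [->|[c [_ ->]]]; [exists (fun=> 0)|]; rewrite big_nil.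
move=> /andP[iNs us]; split=> [[w [w0 /(IH _ us)[c [c0 cE]]]]|[c [c0 ->]]].
  exists (fun j => if j == i then w else c j); split=> [j|]; first by case: eqP.
  rewrite big_cons eqxx (eq_big_seq (fun j => c j *: int_vec R (u j))).
    by rewrite -cE addrC subrK.
  by move=> j js; case: eqP => // ji; rewrite -ji js in iNs.
exists (c i); split=> //; apply/(IH _ us); exists c; split=> //.
by rewrite big_cons addrC addKr.
Qed.

End Cone.

Section Polytope.
Variables (R : realType) (n : nat).
Implicit Types P : set 'rV[R]_n.

Lemma sum_row_mx (I : Type) (s : seq I) (A : I -> 'rV[R]_n) (b : I -> R) :
  \sum_(i <- s) row_mx (A i) (b i)%:M =
  row_mx (\sum_(i <- s) A i) (\sum_(i <- s) b i)%:M :> 'rV_(n + 1).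
Proof.
elim: s => [|i s IH]; first by rewrite !big_nil raddf0 row_mx0.
by rewrite !big_cons IH add_row_mx raddfD.
Qed.

Lemma hull_point (k : nat) (v : 'I_k -> 'rV[R]_n) i : convex_hull v (v i).
Proof.
exists (fun j => (j == i)%:R); split=> [j||]; first exact: ler0n.
  by rewrite (bigD1 i) //= eqxx big1 ?addr0 // => j /negbTE ->.
by rewrite (bigD1 i) //= eqxx scale1r big1 ?addr0 // => j /negbTE ->; rewrite scale0r.
Qed.

(** A point that is a convex combination of the given points with weight less
    than 1 on itself can be dropped: solve the combination for it. *)
Lemma hull_lift (k : nat) (v : 'I_k.+1 -> 'rV[R]_n) (i : 'I_k.+1) (c : 'I_k.+1 -> R) :
  (forall j, 0 <= c j) -> \sum_j c j = 1 -> c i < 1 -> v i = \sum_j c j *: v j ->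
  convex_hull v = convex_hull (fun j => v (lift i j)).
Proof.
move=> c0 c1 ci vi; have ci' : 0 < 1 - c i by rewrite subr_gt0.
have ci0 : 1 - c i != 0 by rewrite gt_eqF.
apply/seteqP; split=> x [w [w0 w1 ->]].
  exists (fun j => w (lift i j) + w i / (1 - c i) * c (lift i j)); split=> [j||].
  - by rewrite addr_ge0 // mulr_ge0 // divr_ge0 // ltW.
  - rewrite big_split -mulr_sumr /=; move: c1 w1; rewrite !(bigD1_ord i) //=.
    move: (\sum_(_ < k) c _) (\sum_(_ < k) w _) => C W cC wW.
    have -> : C = 1 - c i by rewrite -cC addrAC subrr add0r.
    by rewrite divfK // addrC.
  - transitivity (\sum_j (w (lift i j) *: v (lift i j) +
        (w i / (1 - c i)) *: (c (lift i j) *: v (lift i j)))); last first.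
      by apply: eq_bigr => j _; rewrite scalerDl scalerA.
    rewrite [RHS]big_split -scaler_sumr /= (bigD1_ord i) //=.
    move: vi; rewrite (bigD1_ord i) //=.
    move: (\sum_(_ < k) c _ *: _) => C viC.
    have -> : C = (1 - c i) *: v i by rewrite scalerBl scale1r {1}viC addrAC subrr add0r.
    by rewrite scalerA divfK // addrC.
exists (fun j => if unlift i j is Some j' then w j' else 0); split=> [j||].
- by case: unlift.
- rewrite (bigD1_ord i) //= unlift_none add0r -[RHS]w1.
  by apply: eq_bigr => j _; rewrite liftK.
- rewrite (bigD1_ord i) //= unlift_none scale0r add0r.
  by apply: eq_bigr => j _; rewrite liftK.
Qed.

(** In a generating family of least size every point is extreme: if [v i] were
    properly between two points of the polytope, it could be dropped. *)
Lemma hull_of_vertices P : convex_polytope P ->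
  exists (k : nat) (v : 'I_k -> 'rV[R]_n), P = convex_hull v /\ forall i, vertex P (v i).
Proof.
move=> [k0 [v0 v0P]].
have ex : exists k, `[< exists v : 'I_k -> 'rV[R]_n, P = convex_hull v >].
  by exists k0; apply/asboolP; exists v0.
case: (ex_minnP ex) => k /asboolP[v PE] kmin.
exists k, v; split=> // i; split; first by rewrite PE; exact: hull_point.
move=> y z t; rewrite {1 2}PE => -[a [a0 a1 yE]] [b [b0 b1 zE]] /andP[t0 t1] vi.
case: k i v PE kmin a a0 a1 b b0 b1 yE zE vi => [[] //|k] i v PE kmin.
move=> a a0 a1 b b0 b1 yE zE vi.
have ab1 (f : 'I_k.+1 -> R) : (forall j, 0 <= f j) -> \sum_j f j = 1 -> f i <= 1.
  by move=> f0; rewrite (bigD1 i) //= => <-; rewrite lerDl sumr_ge0.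
pose c j := t * a j + (1 - t) * b j.
have c0 j : 0 <= c j.
  by rewrite addr_ge0 // mulr_ge0 ?subr_ge0 // ltW.
have c1 : \sum_j c j = 1.
  by rewrite big_split -!mulr_sumr /= a1 b1; ring.
have viE : v i = \sum_j c j *: v j.
  rewrite {1}vi yE zE !scaler_sumr -big_split; apply: eq_bigr => j _.
  by rewrite /= !scalerA -scalerDl.
have [ci|ci] := ltP (c i) 1.
  have := kmin k; rewrite ltnn => H; suff: false by [].
  by apply: H; apply/asboolP; exists (fun j => v (lift i j)); rewrite PE (hull_lift c0 c1 ci viE).
have ai := ab1 _ a0 a1; have bi := ab1 _ b0 b1; rewrite /c in ci.
have full (f : 'I_k.+1 -> R) : (forall j, 0 <= f j) -> \sum_j f j = 1 -> f i = 1 ->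
    \sum_j f j *: v j = v i.
  move=> f0 f1 fi; rewrite (bigD1 i) //= fi scale1r big1 ?addr0 // => j ji.
  have : \sum_(j | j != i) f j = 0.
    by move: f1; rewrite (bigD1 i) //= fi => /(canRL (addKr _)); rewrite addNr.
  by move=> /eqP; rewrite psumr_eq0 // => /allP /(_ j); rewrite mem_index_enum ji /= => /(_ isT) /eqP ->;
    rewrite scale0r.
by rewrite yE zE !full //; nra.
Qed.

Lemma common_denominator (q : 'I_n -> rat) :
  exists D : nat, (0 < D)%N /\ forall j, exists z : int, D%:R * q j = z%:~R.
Proof.
exists (\prod_j `|denq (q j)|%N)%N; split.
  by apply: prodn_gt0 => j; rewrite absz_gt0 denq_neq0.
move=> j; rewrite (bigD1 j) //= natrM mulrAC.
exists (numq (q j) * (\prod_(i | i != j) `|denq (q i)|%N)%N%:Z).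
rewrite intrM -pmulrn; congr (_ * _).
rewrite -{2}(divq_num_den (q j)) mulrC natr_absz ger0_norm ?denq_ge0 // divfK //.
by rewrite intr_eq0 denq_neq0.
Qed.

(** Clearing denominators, the vertices [v] at height 1 span the same cone as
    integer vectors [(D v, D)], and [N P] is the section of this cone at height
    [N]. So one list of integer inequalities serves for all dilates at once. *)
Lemma rational_polytope_inequalities P : rational_polytope P ->
  exists F : seq 'rV[int]_(n + 1), forall (N : nat) (x : 'rV[R]_n), (0 < N)%N ->
    dilate P N x <-> forall l, l \in F -> 0 <= dot l (row_mx x N%:R%:M).
Proof.
move=> [/hull_of_vertices[k [v [PE vP]]] ratP].
have [q qE] : exists q : 'I_k -> 'I_n -> rat, forall i j, v i 0 j = ratr (q i j).
  have /choice[q qE] : forall i, exists qi : 'I_n -> rat, forall j, v i 0 j = ratr (qi j).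
    by move=> i; have [qi qiE] := choice (ratP _ (vP i)); exists qi.
  by exists q.
have [D DP] := choice (fun i => common_denominator (q i)).
have [z zE] : exists z : 'I_k -> 'I_n -> int, forall i j, (D i)%:R * v i 0 j = (z i j)%:~R.
  have /choice[z zE] : forall i, exists zi : 'I_n -> int, forall j, (D i)%:R * v i 0 j = (zi j)%:~R.
    move=> i; have [zi ziE] := choice (DP i).2; exists zi => j.
    by rewrite qE -(ratr_nat R) -rmorphM ziE /= ratr_int.
  by exists z.
pose u i : 'rV[int]_(n + 1) := row_mx (\row_j z i j) (D i)%:Z%:M.
have uE i : int_vec R (u i) = (D i)%:R *: row_mx (v i) 1%:M.
  rewrite /int_vec map_row_mx map_scalar_mx scale_row_mx scale_scalar_mx mulr1.
  by congr (row_mx _ _); apply/rowP => j; rewrite !mxE zE.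
have [F FP] := cone_finite_inequalities R [seq u i | i <- enum 'I_k].
have coneE x : in_cone [seq u i | i <- enum 'I_k] x <->
    exists c : 'I_k -> R, (forall i, 0 <= c i) /\
      x = row_mx (\sum_i (c i * (D i)%:R) *: v i) (\sum_i c i * (D i)%:R)%:M.
  have E c : \sum_(i <- enum 'I_k) c i *: int_vec R (u i) =
      row_mx (\sum_i (c i * (D i)%:R) *: v i) (\sum_i c i * (D i)%:R)%:M.
    rewrite -sum_row_mx big_enum /=; apply: eq_bigr => i _.
    by rewrite uE scalerA scale_row_mx scale_scalar_mx mulr1.
  rewrite (in_coneP _ _ (enum_uniq _)).
  by split=> -[c [c0 cE]]; exists c; rewrite E in cE *.
exists F => N x N0; rewrite -FP coneE.
have NR0 : N%:R != 0 :> R by rewrite pnatr_eq0 -lt0n.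
have DR0 i : (D i)%:R != 0 :> R by rewrite pnatr_eq0 -lt0n (DP i).1.
split=> [[y]|[c [c0]]].
  rewrite {1}PE => -[w [w0 w1 ->]] <-.
  exists (fun i => N%:R * w i / (D i)%:R); split=> [i|].
    by rewrite divr_ge0 ?mulr_ge0.
  congr (row_mx _ _%:M).
    by rewrite scaler_sumr; apply: eq_bigr => i _; rewrite divfK // scalerA.
  rewrite -[LHS]mulr1 -[X in _ * X = _]w1 mulr_sumr.
  by apply: eq_bigr => i _; rewrite divfK.
move=> /eq_row_mx[-> /matrixP /(_ 0 0)]; rewrite !mxE eqxx !mulr1n => NE.
exists (N%:R^-1 *: \sum_i (c i * (D i)%:R) *: v i); last first.
  by rewrite scalerA mulfV // scale1r.
rewrite PE; exists (fun i => N%:R^-1 * (c i * (D i)%:R)); split=> [i||].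
- by rewrite mulr_ge0 ?invr_ge0 ?mulr_ge0.
- by rewrite -mulr_sumr -NE mulVf.
- by rewrite scaler_sumr; apply: eq_bigr => i _; rewrite scalerA.
Qed.

Lemma convex_polytope_bounded P : convex_polytope P ->
  exists B : nat, forall x, P x -> forall j, `|x 0 j| < B%:R.
Proof.
move=> [k [v ->]]; pose S : R := \sum_i \sum_j `|v i 0 j|.
have S0 : 0 <= S by rewrite !sumr_ge0 // => i _; rewrite sumr_ge0.
exists (Num.bound S) => x [w [w0 w1 ->]] j.
apply: le_lt_trans (archi_boundP S0); rewrite summxE.
apply: le_trans (ler_norm_sum _ _ _) _; apply: ler_sum => i _.
have wi1 : w i <= 1 by rewrite -w1 (bigD1 i) //= lerDl sumr_ge0.
rewrite mxE normrM (ger0_norm (w0 i)) (bigD1 j) //=.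
apply: le_trans (_ : `|v i 0 j| <= _); first by rewrite ler_piMl.
by rewrite lerDl sumr_ge0.
Qed.

End Polytope.

(** * Counting lattice points of slices *)

Lemma lattice_count_seq (R : realType) (n : nat) (Q : set 'rV[R]_n) (N : nat)
    (s : seq 'rV[R]_n) :
  uniq s -> dilate Q N `&` @integer_lattice R n = [set` s] ->
  lattice_count Q N = size s.
Proof.
move=> us E; rewrite /lattice_count E.
have -> : [set` s] = [set` [fset x in s]%fset].
  by apply/seteqP; split=> x /=; rewrite inE.
by rewrite set_fsetK card_fseq undup_id.
Qed.

Section Count.
Variables (R : realType) (d : nat) (P : set 'rV[R]_d.+1).
Variables (F : seq 'rV[int]_(d.+1 + 1)) (B : nat).
Hypothesis FP : forall (N : nat) (x : 'rV[R]_d.+1), (0 < N)%N ->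
  dilate P N x <-> forall l, l \in F -> 0 <= dot l (row_mx x N%:R%:M).
Hypothesis BP : forall x, P x -> forall j, `|x 0 j| < B%:R.

(* An integer vector e = (x, N) encodes the point x and the dilation factor N.
   The coordinates of x other than the height (the last one) are summed over. *)
Notation scale_idx := (rshift d.+1 (ord0 : 'I_1)).
Notation height_idx := (lshift 1 (ord_max : 'I_d.+1)).

Definition box_radius (e : 'rV[int]_(d.+1 + 1)) : int := B%:Z * e 0 scale_idx.

Definition free_coords : seq 'I_(d.+1 + 1) :=
  [seq lshift 1 i | i <- enum 'I_d.+1 & i != ord_max].

Definition satisfies (e : 'rV[int]_(d.+1 + 1)) : bool :=
  all (fun l : 'rV[int]_(d.+1 + 1) => 0 <= \sum_j l 0 j * e 0 j) F.

Definition slice_points (e : 'rV[int]_(d.+1 + 1)) : seq 'rV[R]_d.+1 :=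
  [seq int_vec R (lsubmx e') | e' <- box_points box_radius free_coords e & satisfies e'].

Lemma free_coordsP j : j \in free_coords <-> exists2 i, j = lshift 1 i & i != ord_max.
Proof.
split=> [/mapP[i]|[i -> im]]; first by rewrite mem_filter => /andP[im _] ->; exists i.
by apply/mapP; exists i; rewrite // mem_filter im mem_enum.
Qed.

Lemma scale_idx_free : scale_idx \notin free_coords.
Proof.
by apply/negP => /free_coordsP[i /eqP]; rewrite eq_sym eq_lrshift.
Qed.

Lemma height_idx_free : height_idx \notin free_coords.
Proof.
by apply/negP => /free_coordsP[i /eqP]; rewrite eq_lshift => /eqP <-; rewrite eqxx.
Qed.

Lemma uniq_free_coords : uniq free_coords.
Proof. by rewrite map_inj_uniq ?filter_uniq -?enumT ?enum_uniq // => i j /eqP; rewrite eq_lshift => /eqP. Qed.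

Lemma box_radius_free i x e : i \in free_coords ->
  box_radius (set_coord e i x) = box_radius e.
Proof.
move=> iF; rewrite /box_radius mxE; case: eqP => // si.
by have := scale_idx_free; rewrite si iF.
Qed.

Definition mem_box e e' :=
  mem_box_points e e' uniq_free_coords box_radius_free.

Lemma dilate_slice (lam : rat) (N : nat) x : (0 < N)%N ->
  dilate (slice P lam) N x <->
  dilate P N x /\ x 0 ord_max = N%:R * ratr lam.
Proof.
move=> N0; have NR0 : N%:R != 0 :> R by rewrite pnatr_eq0 -lt0n.
split=> [[y [Py /= yl] <-]|[[y Py <-]]]; first by split; [exists y|rewrite mxE yl].
by rewrite mxE => /(mulfI NR0) yl; exists y.
Qed.

(** The inequalities are evaluated on integers, which makes them indicators of the
    kind allowed in piecewise quasi-polynomials. *)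
Lemma satisfies_dilate (N : nat) (e : 'rV[int]_(d.+1 + 1)) : (0 < N)%N ->
  e 0 scale_idx = N%:Z -> satisfies e <-> dilate P N (int_vec R (lsubmx e)).
Proof.
move=> N0 eN; rewrite (FP _ N0).
have -> : row_mx (int_vec R (lsubmx e)) N%:R%:M = int_vec R e.
  rewrite -[in RHS](hsubmxK e) [in RHS]/int_vec map_row_mx; congr row_mx.
  by apply/rowP => j; rewrite !mxE ord1 eqxx mulr1n eN.
split=> [/allP eF l /eF|eF]; first by rewrite dot_int_vec ler0z.
by apply/allP => l /eF; rewrite dot_int_vec ler0z.
Qed.

(** The box of radius [B N] contains [N P], so the points found in it are all the
    lattice points. *)
Lemma slice_pointsE (lam : rat) (N : nat) (e : 'rV[int]_(d.+1 + 1)) : (0 < N)%N ->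
  e 0 scale_idx = N%:Z -> (e 0 height_idx)%:~R = N%:R * ratr lam :> R ->
  dilate (slice P lam) N `&` @integer_lattice R d.+1 = [set` slice_points e].
Proof.
move=> N0 eN eh; apply/seteqP; split=> [x [/(dilate_slice _ _ N0)[xP xh] xZ]|x].
  have [z zE] : exists z : 'I_d.+1 -> int, forall j, x 0 j = (z j)%:~R.
    have /choice[z zE] : forall j, exists zj : int, x 0 j = zj%:~R.
      by move=> j; exact/intrP/xZ.
    by exists z.
  pose e' : 'rV[int]_(d.+1 + 1) := row_mx (\row_j z j) N%:Z%:M.
  have xE : int_vec R (lsubmx e') = x.
    by rewrite row_mxKl; apply/rowP => j; rewrite !mxE zE.
  have e'N : e' 0 scale_idx = N%:Z by rewrite row_mxEr mxE eqxx mulr1n.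
  apply/mapP; exists e' => //; rewrite mem_filter; apply/andP; split.
    by apply/(satisfies_dilate N0 e'N); rewrite xE.
  apply/mem_box; split=> j.
    case: (split_ordP j) => i ->; last by rewrite ord1 e'N eN.
    have [-> _|im] := eqVneq i ord_max.
      rewrite row_mxEl mxE; apply: (@intr_inj R).
      by rewrite eh -xh zE.
    by move=> /negP[]; apply/free_coordsP; exists i.
  move=> /free_coordsP[i -> _]; rewrite row_mxEl mxE /box_radius eN.
  have [y Py yx] := xP; have := BP Py i; rewrite ltr_norml => /andP[yl yu].
  have NR0 : 0 < N%:R :> R by rewrite ltr0n.
  have zy : (z i)%:~R = N%:R * y 0 i :> R by rewrite -zE -yx mxE.
  rewrite -(ler_int R) -(ltr_int R) zy intrN intrM -!pmulrn.
  by apply/andP; split; nra.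
move=> /mapP[e' +] ->; rewrite mem_filter => /andP[e'F /mem_box[e'e _]].
have e'N : e' 0 scale_idx = N%:Z by rewrite e'e ?eN // scale_idx_free.
split; last by move=> j; rewrite mxE; exact: intr_int.
apply/(dilate_slice _ _ N0); split; first exact/(satisfies_dilate N0).
by rewrite !mxE e'e ?height_idx_free.
Qed.

Lemma uniq_slice_points e : uniq (slice_points e).
Proof.
rewrite map_inj_in_uniq ?filter_uniq ?uniq_box_points ?uniq_free_coords //.
  exact: box_radius_free.
move=> e1 e2; rewrite !mem_filter => /andP[_ /mem_box[h1 _]] /andP[_ /mem_box[h2 _]].
move=> /matrixP E; rewrite -(hsubmxK e1) -(hsubmxK e2); congr row_mx.
  by apply/rowP => j; have /eqP := E 0 j; rewrite !mxE eqr_int => /eqP.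
by apply/rowP => j; rewrite !mxE ord1 h1 ?h2 // scale_idx_free.
Qed.

Lemma lattice_count_slice (lam : rat) (N : nat) (e : 'rV[int]_(d.+1 + 1)) : (0 < N)%N ->
  e 0 scale_idx = N%:Z -> (e 0 height_idx)%:~R = N%:R * ratr lam :> R ->
  lattice_count (slice P lam) N = size (slice_points e).
Proof.
by move=> N0 eN eh; apply: lattice_count_seq (uniq_slice_points e) (slice_pointsE N0 eN eh).
Qed.

(** The number of lattice points as one function of dilation factor and height,
    for all slices simultaneously. *)
Lemma pqp_slice_points :
  piecewise_qp (@affine_form (d.+1 + 1)) (fun e => (size (slice_points e))%:R : R).
Proof.
have Lb : affine_form box_radius by exact: affine_form_coord.
have Lc := affine_form_closed (d.+1 + 1).
have Ll (l : 'rV[int]_(d.+1 + 1)) :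
    piecewise_qp (@affine_form _) (fun e => (0 <= \sum_j l 0 j * e 0 j)%R%:R : R).
  apply: Pqp_ge0; exists (fun j => l 0 j), 0.
  by apply/funext => e; rewrite addr0.
apply: eq_pqp (pqp_box_sum free_coords Lb (pqp_prod F Ll)) => e.
rewrite /slice_points size_map size_filter -sum1_count natr_sum [RHS]big_mkcond /=.
apply: eq_bigr => e' _; rewrite /satisfies.
elim: F => [|l F' IH]; first by rewrite big_nil.
rewrite big_cons IH /=; case: (0 <= _); rewrite ?mul0r ?mul1r //.
Qed.

End Count.

(** * Lattice points in large dilates and leading coefficients *)

Lemma dot_sum (R : realType) (m k : nat) (l : 'rV[int]_m) (c : 'I_k -> R)
    (x : 'I_k -> 'rV[R]_m) :
  dot l (\sum_i c i *: x i) = \sum_i c i * dot l (x i).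
Proof.
rewrite /dot; under [RHS]eq_bigr do rewrite mulr_sumr.
rewrite exchange_big; apply: eq_bigr => j _; rewrite summxE mulr_sumr.
by apply: eq_bigr => i _; rewrite mxE mulrCA.
Qed.

Lemma dilateD (R : realType) (n : nat) (P : set 'rV[R]_n) (a b : nat) x y :
  rational_polytope P -> (0 < a)%N -> (0 < b)%N ->
  dilate P a x -> dilate P b y -> dilate P (a + b) (x + y).
Proof.
move=> /rational_polytope_inequalities[F FP] a0 b0.
rewrite !FP ?addn_gt0 ?a0 // => xF yF l lF.
by rewrite natrD raddfD -add_row_mx dotDr addr_ge0 ?xF ?yF.
Qed.

Section Height.
Variables (R : realType) (d : nat).
Notation diff_mx p := (\matrix_i (p (lift ord0 i) - p ord0)).
Let top : 'cV[R]_d.+1 := delta_mx ord_max 0.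

Lemma diff_mx_top (k : nat) (p : 'I_k.+1 -> 'rV[R]_d.+1) (h : R) :
  (forall i, p i 0 ord_max = h) -> diff_mx p *m top = 0.
Proof.
move=> ph; apply/matrixP => i j; rewrite ord1 -colE !mxE !ph subrr //.
Qed.

(** The differences of points at equal height are killed by the last basis
    vector, so at most [d] of them are independent. *)
Lemma affine_dim_hyperplane (Q : set 'rV[R]_d.+1) (h : R) :
  (forall x, Q x -> x 0 ord_max = h) -> (affine_dim Q <= d)%N.
Proof.
move=> Qh; apply/bigmax_leqP => k /asboolP[p [Qp pfree]].
have := mulmx0_rank_max (diff_mx_top (fun i => Qh _ (Qp i))).
by move: pfree; rewrite /affinely_independent /row_free mxrank_delta => /eqP ->; rewrite addn1.
Qed.

Lemma full_affine_dim_points (Q : set 'rV[R]_d.+1) : Q !=set0 -> affine_dim Q = d ->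
  exists p : 'I_d.+1 -> 'rV[R]_d.+1, (forall i, Q (p i)) /\ affinely_independent p.
Proof.
move=> [x Qx] dimQ.
pose A := [pred k : 'I_d.+2 | `[< exists p : 'I_k.+1 -> 'rV[R]_d.+1,
                         (forall i, Q (p i)) /\ affinely_independent p >]].
have A0 : (0 < #|A|)%N.
  apply/card_gt0P; exists ord0; rewrite inE; apply/asboolP/asboolP.
  by exists (fun=> x); split=> //; rewrite /affinely_independent /row_free flatmx0 mxrank0.
have [k] := eq_bigmax_cond (fun k : 'I_d.+2 => k : nat) A0.
rewrite inE => /asboolP/asboolP kp E; move: dimQ; rewrite /affine_dim.
have -> : \max_(k < d.+2 | `[< exists p : 'I_k.+1 -> 'rV[R]_d.+1,
     (forall i, Q (p i)) /\ affinely_independent p >]) k = k :> nat by rewrite -E.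
by move=> kd; rewrite kd in kp.
Qed.

(** The differences of the [p i] span all vectors of height 0, so bounded vectors
    of height 0 have bounded coordinates with respect to them. *)
Lemma hyperplane_combination (p : 'I_d.+1 -> 'rV[R]_d.+1) (h : R) :
  affinely_independent p -> (forall i, p i 0 ord_max = h) ->
  exists S : R, forall v : 'rV[R]_d.+1, v 0 ord_max = 0 -> (forall j, `|v 0 j| <= 1) ->
    exists mu : 'I_d.+1 -> R, [/\ \sum_i mu i = 0, v = \sum_i mu i *: p i &
      forall i, `|mu i| <= S].
Proof.
move=> pfree ph; set A := diff_mx p.
have Atop : A *m top = 0 by exact: diff_mx_top ph.
have rA : \rank A = d by apply/eqP.
have kA : (kermx top <= A)%MS.
  have sA : (A <= kermx top)%MS by exact/sub_kermxP.
  have := mxrank_leqif_sup sA => -[_ <-].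
  by rewrite mxrank_ker mxrank_delta rA subn1.
pose T : R := \sum_i \sum_j `|pinvmx A j i|.
exists T => v v0 v1.
have vA : (v <= A)%MS.
  apply: submx_trans kA; apply/sub_kermxP/matrixP => i j.
  by rewrite !ord1 -colE !mxE v0.
pose nu := v *m pinvmx A.
have nuE : v = \sum_i nu 0 i *: (p (lift ord0 i) - p ord0).
  rewrite -{1}(mulmxKpV vA) -/nu mulmx_sum_row.
  by apply: eq_bigr => i _; rewrite rowK.
have nuT : \sum_i `|nu 0 i| <= T.
  apply: ler_sum => i _; rewrite mxE; apply: le_trans (ler_norm_sum _ _ _) _.
  by apply: ler_sum => j _; rewrite normrM ler_piMl.
exists (fun i => if unlift ord0 i is Some j then nu 0 j else - \sum_j nu 0 j).
split=> [||i].
- rewrite big_ord_recl unlift_none.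
  by under [X in _ + X]eq_bigr do rewrite liftK; rewrite addNr.
- rewrite big_ord_recl unlift_none.
  under [X in _ + X]eq_bigr do rewrite liftK.
  rewrite {1}nuE (eq_bigr _ (fun i _ => scalerBr _ _ _)).
  by rewrite big_split /= sumrN -scaler_suml scaleNr addrC.
- apply: le_trans nuT; case: unliftP => [j _|_].
    by rewrite (bigD1 j) //= lerDl sumr_ge0.
  by rewrite normrN ler_norm_sum.
Qed.

(** Round the barycenter of the dilated simplex to a lattice point of the right
    height: this changes the barycentric coordinates, which are [K / (d + 1)], by a
    bounded amount only, so they stay nonnegative for large [K]. *)
Lemma lattice_point_in_dilate (P : set 'rV[R]_d.+1) (lam : rat) :
  rational_polytope P -> slice P lam !=set0 -> affine_dim (slice P lam) = d ->
  exists K0 : nat, forall K, (K0 <= K)%N -> lam * K%:R \is a Num.int ->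
    (dilate (slice P lam) K `&` @integer_lattice R d.+1) !=set0.
Proof.
move=> ratP Q0 dimQ; have [F FP] := rational_polytope_inequalities ratP.
have [p [Qp pfree]] := full_affine_dim_points Q0 dimQ.
have ph i : p i 0 ord_max = ratr lam by have [_] := Qp i.
have [S SP] := hyperplane_combination pfree ph.
have d1 : 0 < d.+1%:R :> R by rewrite ltr0n.
have S0 : 0 <= d.+1%:R * `|S| by rewrite mulr_ge0.
exists (Num.bound (d.+1%:R * `|S|)).+1 => K K0K lamK.
have K0 : (0 < K)%N by exact: leq_trans K0K.
have KS : d.+1%:R * S <= K%:R.
  apply: le_trans (_ : d.+1%:R * `|S| <= _).
    by rewrite ler_wpM2l ?ler_norm // ltW.
  by apply/ltW/(lt_trans (archi_boundP S0)); rewrite ltr_nat.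
pose g : 'rV[R]_d.+1 := \sum_i (K%:R / d.+1%:R) *: p i.
pose x : 'rV[R]_d.+1 :=
  \row_j (if j == ord_max then K%:R * ratr lam else (Num.floor (g 0 j))%:~R).
have gtop : g 0 ord_max = K%:R * ratr lam.
  rewrite summxE; under eq_bigr do rewrite mxE ph.
  by rewrite sumr_const card_ord -[LHS]mulr_natr mulrAC divfK // gt_eqF.
have [||mu [mu0 xg muS]] := SP (x - g).
- by rewrite !mxE eqxx gtop subrr.
- move=> j; rewrite !mxE; case: eqP => [->|_]; first by rewrite gtop subrr normr0.
  have := Num.Theory.floor_le (g 0 j); have := Num.Theory.floorD1_gt (g 0 j); rewrite ler_norml => h1 h2.
  by move: h1; rewrite intrD; lra.
pose c i := K%:R / d.+1%:R + mu i.
have c0 i : 0 <= c i.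
  have := muS i; rewrite ler_norml => /andP[h _].
  rewrite -lerBlDr sub0r (le_trans (_ : _ <= S)) 1?lerNl //.
  by rewrite ler_pdivlMr // mulrC.
have cK : \sum_i c i = K%:R.
  by rewrite big_split /= mu0 addr0 sumr_const card_ord -[LHS]mulr_natr divfK // gt_eqF.
have xc : x = \sum_i c i *: p i.
  rewrite -(subrK g x) xg addrC -big_split; apply: eq_bigr => i _.
  by rewrite /= scalerDl.
exists x; split; last first.
  move=> j; rewrite mxE; case: eqP => _; last exact: intr_int.
  move: lamK => /intrP[z zE]; rewrite -(ratr_nat R) -rmorphM mulrC zE.
  by rewrite /= ratr_int intr_int.
apply/dilate_slice => //; split; last by rewrite mxE eqxx.
apply/FP => // l lF; rewrite xc -cK.
have -> : row_mx (\sum_i c i *: p i) (\sum_i c i)%:M =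
    \sum_i c i *: row_mx (p i) 1%:R%:M :> 'rV_(d.+1 + 1).
  rewrite -sum_row_mx; apply: eq_bigr => i _.
  by rewrite scale_row_mx scale_scalar_mx mulr1.
rewrite dot_sum; apply: sumr_ge0 => i _; apply: mulr_ge0 => //.
have : dilate P 1 (p i) by exists (p i); rewrite ?scale1r //; have [] := Qp i.
by move=> /FP; apply.
Qed.

End Height.

Lemma coef_comp_shift (R : realType) (d : nat) (q : {poly R}) (a : R) :
  (size q <= d.+1)%N -> (q \Po ('X + a%:P))`_d = q`_d.
Proof.
move=> qd; have sX : size ('X + a%:P) = 2%N by rewrite size_XaddC.
have sq := size_comp_poly2 q sX.
move: qd; rewrite leq_eqVlt => /orP[/eqP qd|qd]; last first.
  by rewrite !nth_default ?sq.
have := @lead_coef_comp _ q ('X + a%:P).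
by rewrite sX lead_coefXaddC expr1n mulr1 /lead_coef sq qd => /(_ isT).
Qed.

Lemma leading_coef_le (R : realType) (d T n0 K : nat) (p q : {poly R}) : (0 < T)%N ->
  (size p <= d.+1)%N -> (size q <= d.+1)%N ->
  (forall k, (0 < k)%N -> p.[(n0 + k * T)%N%:R] <= q.[(n0 + k * T + K)%N%:R]) ->
  p`_d <= q`_d.
Proof.
move=> T0 pd qd pq; rewrite leNgt; apply/negP => qp.
pose q' := q \Po ('X + (K%:R)%:P); pose r := p - q'.
have q'd : size q' = size q by rewrite size_comp_poly2 // size_XaddC.
have rd : 0 < r`_d by rewrite coefB coef_comp_shift // subr_gt0.
have sr : size r = d.+1.
  apply/eqP; rewrite eqn_leq; apply/andP; split.
    by rewrite (leq_trans (size_polyD _ _)) // size_polyN geq_max pd q'd.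
  by rewrite ltnNge; apply/negP => /leq_sizeP/(_ _ (leqnn _)) r0; rewrite r0 ltxx in rd.
have lr : 0 < lead_coef r by rewrite /lead_coef sr.
have [b bP] := polyrcf.poly_pinfty_gt_lc lr.
pose k := (Num.bound `|b|).+1.
have : b <= (n0 + k * T)%N%:R.
  apply: le_trans (ler_norm b) _; apply: le_trans (ltW (archi_boundP (normr_ge0 b))) _.
  by rewrite ler_nat (leq_trans (leqnSn _)) // (leq_trans _ (leq_addl _ _)) // leq_pmulr.
move=> /bP; apply/negP; rewrite -ltNge; apply: le_lt_trans lr.
rewrite /r hornerD hornerN horner_comp hornerD hornerX hornerC subr_le0 -natrD; exact: pq.
Qed.

(** * Ehrhart coefficients of slices *)

Lemma ehrhart_common_period (R : realType) (n : nat) (Q : set 'rV[R]_n)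
    (C : nat -> nat -> R) : is_ehrhart Q C ->
  exists2 T : nat, (0 < T)%N & forall i m k, C i (m + k * T)%N = C i m.
Proof.
move=> [_ Cper C0 _]; have /choice[N NP] : forall i, exists N, (0 < N)%N /\ forall m, C i (m + N)%N = C i m.
  by move=> i; have [N N0 CN] := Cper i; exists N.
have NE i m k : C i (m + k * N i)%N = C i m.
  by elim: k => [|k IH]; rewrite ?addn0 // mulSn addnCA addnC (NP i).2 IH.
exists (\prod_(i < (affine_dim Q).+1) N i)%N => [|i m k].
  by apply: prodn_gt0 => i; exact: (NP i).1.
have [id|id] := ltnP (affine_dim Q) i; first by rewrite !C0.
by rewrite (bigD1 (Ordinal (id : (i < (affine_dim Q).+1)%N))) //= mulnCA mulnC NE.
Qed.

Section EhrhartPoly.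
Variables (R : realType) (n : nat) (Q : set 'rV[R]_n) (C : nat -> nat -> R).
Hypothesis ehrC : is_ehrhart Q C.

Definition ehrhart_poly (m : nat) : {poly R} := \poly_(i < (affine_dim Q).+1) C i m.

Lemma coef_ehrhart_poly m i : (ehrhart_poly m)`_i = C i m.
Proof.
by rewrite coef_poly ltnS; case: leqP => // id; have [_ _ -> ] := ehrC.
Qed.

Lemma ehrhart_polyE m N : (forall i, C i N = C i m) ->
  (ehrhart_poly m).[N%:R] = (lattice_count Q N)%:R.
Proof.
move=> CN; have [-> _ _ _] := ehrC; rewrite horner_poly.
by apply: eq_bigr => i _; rewrite CN.
Qed.

End EhrhartPoly.

Lemma poly_eq_unbounded (R : realType) (p q : {poly R}) (x : nat -> nat) :
  injective x -> (forall k, p.[(x k)%:R] = q.[(x k)%:R]) -> p = q.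
Proof.
move=> xinj pq; apply/eqP; rewrite -subr_eq0; apply: contrapT => /negP r0.
have := max_poly_roots r0 (rs := [seq (x k)%:R | k <- iota 0 (size (p - q))]).
rewrite size_map size_iota ltnn => H; suff: false by [].
apply: H.
  by apply/allP => y /mapP[k _ ->]; rewrite /root !hornerE pq subrr.
by rewrite map_inj_uniq ?iota_uniq // => a b /eqP; rewrite eqr_nat => /eqP /xinj.
Qed.

(** The second alternative is the default value of [ehrhart_coef]. *)
Lemma ehrhart_coefP (R : realType) (n : nat) (Q : set 'rV[R]_n) :
  is_ehrhart Q (ehrhart_coef Q) \/ forall i m, ehrhart_coef Q i m = 0.
Proof.
have [[C CP]|noC] := pselect (exists C, is_ehrhart Q C).
  by left; exact: (xgetPex _ (ex_intro _ C CP)).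
by right=> i m; rewrite /ehrhart_coef xgetPN // => C CP; apply: noC; exists C.
Qed.

Section Slice.
Variables (R : realType) (d : nat) (P : set 'rV[R]_d.+1).
Hypothesis ratP : rational_polytope P.

Definition ray_point (z : int) (N : nat) : 'rV[int]_(d.+1 + 1) :=
  row_mx (\row_j (if j == ord_max then z else 0)) N%:Z%:M.

Lemma ray_point_scale z N : ray_point z N 0 (rshift d.+1 (ord0 : 'I_1)) = N%:Z.
Proof. by rewrite row_mxEr mxE eqxx mulr1n. Qed.

Lemma ray_point_height z N : ray_point z N 0 (lshift 1 (ord_max : 'I_d.+1)) = z.
Proof. by rewrite row_mxEl mxE eqxx. Qed.

Lemma ray_pointMD z N z' N' k :
  ray_point z N + ray_point z' N' *+ k = ray_point (z + z' *+ k) (N + k * N')%N.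
Proof.
apply/rowP => j; rewrite mxE mulmxnE.
case: (split_ordP j) => i ->; rewrite ?row_mxEl ?row_mxEr !mxE.
  by case: eqP => // _; rewrite mul0rn addr0.
by rewrite ord1 eqxx !mulr1n PoszD PoszM -[N'%:Z *+ k]mulr_natl natz.
Qed.

(** The ray through the points [ray_point z N] with [z / N = h]. *)
Definition ray_slope (h : R) (j : 'I_(d.+1 + 1)) : R :=
  row_mx (\row_(i < d.+1) (if i == ord_max then h else 0)) 1%:M 0 j.

Lemma ray_pointE z N h : z%:~R = N%:R * h ->
  forall j, (ray_point z N 0 j)%:~R = N%:R * ray_slope h j.
Proof.
move=> zh j; rewrite /ray_slope.
case: (split_ordP j) => i ->; rewrite ?row_mxEl ?row_mxEr !mxE.
  by case: eqP => // _; rewrite mulr0.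
by rewrite ord1 eqxx !mulr1n mulr1 -pmulrn.
Qed.

Lemma ray_slope_le h B : `|h| <= B -> 1 <= B -> forall j, `|ray_slope h j| <= B.
Proof.
move=> hB B1 j; rewrite /ray_slope.
case: (split_ordP j) => i ->; rewrite ?row_mxEl ?row_mxEr !mxE.
  by case: eqP => // _; rewrite normr0 (le_trans ler01).
by rewrite ord1 eqxx mulr1n normr1.
Qed.

Lemma height_real (lam : rat) (N : nat) (z : int) : lam * N%:R = z%:~R ->
  z%:~R = N%:R * ratr lam :> R.
Proof. by move=> E; rewrite -(ratr_int R z) -E rmorphM /= ratr_nat mulrC. Qed.

Lemma denq_period (lam : rat) (T0 : nat) :
  lam * (T0 * `|denq lam|)%N%:R = (numq lam * T0%:Z)%:~R.
Proof.
rewrite intrM numqE natrM natr_absz ger0_norm ?denq_ge0 // -pmulrn; ring.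
Qed.

Lemma lattice_points_slice (lam : rat) (N : nat) (z : int) : (0 < N)%N ->
  lam * N%:R = z%:~R -> exists s : seq 'rV[R]_d.+1, [/\ uniq s,
    dilate (slice P lam) N `&` @integer_lattice R d.+1 = [set` s] &
    lattice_count (slice P lam) N = size s].
Proof.
move=> N0 zE; have [F FP] := rational_polytope_inequalities ratP.
have [B BP] := convex_polytope_bounded ratP.1.
have E := slice_pointsE FP BP N0 (ray_point_scale z N).
rewrite ray_point_height in E; have {}E := E lam (height_real zE).
exists (slice_points R F B (ray_point z N)); split=> //; first exact: uniq_slice_points.
by apply: lattice_count_seq => //; exact: uniq_slice_points.
Qed.

(** For [n] in the class of [n0], the point [(lam n, n)] moves along a ray of
    slope [lam], where the counting function is eventually a polynomial with
    coefficients bounded by [c]. This polynomial agrees with the Ehrhart polynomial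
    of the class infinitely often. Nonempty slices have bounded [lam], which bounds
    the slopes. *)
Lemma slice_coef_bounded : exists c : nat -> R, forall (lam : rat) i n, lam * n%:R \is a Num.nat ->
  `|ehrhart_coef (slice P lam) i n| <= c i.
Proof.
have [F FP] := rational_polytope_inequalities ratP.
have [B BP] := convex_polytope_bounded ratP.1.
have [c cP] := pqp_along_ray (B%:R + 1) (pqp_slice_points R F B).
exists (fun i => `|c i|) => lam i n0 /natrP[z0 z0E].
case: (ehrhart_coefP (slice P lam)) => [|->]; last by rewrite normr0.
move: (ehrhart_coef _) => C ehrC.
have [Q0|/set0P[x [Px xlam]]] := eqVneq (slice P lam) set0.
  by have [_ _ _ ->] := ehrC; rewrite ?normr0.
have [T0 T00 CT] := ehrhart_common_period ehrC.
pose T := (T0 * `|denq lam|)%N.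
have T_gt0 : (0 < T)%N by rewrite muln_gt0 T00 absz_gt0 denq_neq0.
pose zT := numq lam * T0%:Z.
have zTE : lam * T%:R = zT%:~R by exact: denq_period.
have lamB : `|ratr lam : R| <= B%:R + 1.
  by have := BP _ Px ord_max; rewrite xlam => h; rewrite (le_trans (ltW h)) // lerDl.
have B1 : 1 <= B%:R + 1 :> R by rewrite lerDr.
have z0R : (z0%:Z)%:~R = n0%:R * ratr lam :> R by apply: height_real; rewrite z0E -pmulrn.
have [M [K [p [M0 pc pE]]]] := cP _ _ _ _ _ T_gt0 (ray_slope_le lamB B1)
  (ray_pointE z0R) (ray_pointE (height_real zTE)).
suff pC : p = ehrhart_poly (slice P lam) C n0.
  by rewrite -(coef_ehrhart_poly ehrC n0 i) -pC (le_trans (pc i)) // ler_norm.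
pose N k := (n0 + (M * (K.+1 + k)) * T)%N.
apply: (poly_eq_unbounded (x := N)) => [k k'|k].
  by rewrite /N => /addnI/eqP; rewrite eqn_pmul2r // eqn_pmul2l // => /eqP /addnI.
rewrite -pE ?dvdn_mulr //; last first.
  by rewrite (leq_trans _ (leq_pmull _ M0)) // addSn leqW // leq_addr.
have Nk0 : (0 < N k)%N by rewrite /N addn_gt0 [X in _ || X]muln_gt0 T_gt0 andbT muln_gt0 M0 orbT.
rewrite (ehrhart_polyE ehrC); last first.
  by move=> j; rewrite /N /T mulnCA mulnC CT.
rewrite ray_pointMD (lattice_count_slice FP BP Nk0 (ray_point_scale (z0%:Z + zT *+ (M * (K.+1 + k))) _)) //.
rewrite ray_point_height; apply: height_real; rewrite /N.
rewrite natrD natrM mulrDr z0E mulrCA zTE.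
by rewrite intrD -[zT *+ _]mulr_natl natz intrM -!pmulrn.
Qed.

(** Adding a lattice point of the [K]-th dilate maps the lattice points of the
    [N]-th dilate injectively to those of the [(N + K)]-th one. *)
Lemma lattice_count_slice_le (lam : rat) (N K : nat) : (0 < N)%N -> (0 < K)%N ->
  lam * N%:R \is a Num.int -> lam * K%:R \is a Num.int ->
  (dilate (slice P lam) K `&` @integer_lattice R d.+1) !=set0 ->
  (lattice_count (slice P lam) N <= lattice_count (slice P lam) (N + K))%N.
Proof.
move=> N0 K0 /intrP[z zE] /intrP[t tE] [y [Qy Zy]].
have NK0 : (0 < N + K)%N by rewrite addn_gt0 N0.
have [s [us sE ->]] := lattice_points_slice N0 zE.
have ztE : lam * (N + K)%N%:R = (z + t)%:~R by rewrite natrD mulrDr zE tE intrD.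
have [r [ur rE ->]] := lattice_points_slice NK0 ztE.
rewrite -(size_map (fun x => x + y)); apply: uniq_leq_size.
  by rewrite map_inj_uniq //; exact: addIr.
move=> _ /mapP[x xs ->].
have [Qx Zx] : (dilate (slice P lam) N `&` @integer_lattice R d.+1) x by rewrite sE.
suff : [set` r] (x + y) by [].
rewrite -rE; split; last by move=> j; rewrite mxE rpredD.
move: Qx Qy.
move=> /(dilate_slice _ _ _ N0)[Px xl] /(dilate_slice _ _ _ K0)[Py yl].
apply/(dilate_slice _ _ _ NK0); split; first exact: dilateD.
by rewrite mxE xl yl natrD mulrDl.
Qed.

(** Choose [K] in the class of [n1 - n0], so large that the [K]-th dilate contains
    a lattice point. Then the count on the class of [n0] is at most the count,
    shifted by [K], on the class of [n1], and leading coefficients compare. *)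
Lemma slice_top_coef_le (lam : rat) (C : nat -> nat -> R) (n0 n1 : nat) :
  is_ehrhart (slice P lam) C ->
  lam * n0%:R \is a Num.int -> lam * n1%:R \is a Num.int -> C d n0 <= C d n1.
Proof.
move=> ehrC lam0 lam1.
have [Q0|/set0P Q0] := eqVneq (slice P lam) set0.
  by have [_ _ _ C0] := ehrC; rewrite !C0.
have dimle : (affine_dim (slice P lam) <= d)%N.
  by apply: (@affine_dim_hyperplane _ _ _ (ratr lam)) => x [].
move: (dimle); rewrite leq_eqVlt => /orP[/eqP dimE|dimlt]; last first.
  by have [_ _ C0 _] := ehrC; rewrite !C0.
have [K0 K0P] := lattice_point_in_dilate ratP Q0 dimE.
have [T0 T00 CT] := ehrhart_common_period ehrC.
pose T := (T0 * `|denq lam|)%N.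
have T_gt0 : (0 < T)%N by rewrite muln_gt0 T00 absz_gt0 denq_neq0.
have lamT : lam * T%:R \is a Num.int by rewrite denq_period intr_int.
have CTd m k i : C i (m + k * T)%N = C i m.
  by rewrite /T [(T0 * _)%N]mulnC mulnA CT.
(* n0 * T.-1 is - n0 modulo T *)
pose K := (n1 + n0 * T.-1 + K0.+1 * T)%N.
have lamK : lam * K%:R \is a Num.int.
  have -> : lam * K%:R = lam * n1%:R + lam * n0%:R * T.-1%:R +
      K0.+1%:R * (lam * T%:R) by rewrite /K !natrD !natrM; ring.
  by rewrite !rpredD // rpredM // rpred_nat.
have Kpos : (0 < K)%N by rewrite addn_gt0 muln_gt0 T_gt0 orbT.
have K0K : (K0 <= K)%N.
  rewrite /K (leq_trans _ (leq_addl _ _)) // (leq_trans (leqnSn _)) //.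
  by rewrite leq_pmulr.
have n0K : (n0 + K = n1 + (n0 + K0.+1) * T)%N.
  by rewrite /K mulnDl -{3}(prednK T_gt0) mulnS; lia.
rewrite -(coef_ehrhart_poly ehrC n0) -(coef_ehrhart_poly ehrC n1).
apply: (leading_coef_le (T := T) (n0 := n0) (K := K)) => //.
- by rewrite (leq_trans (size_poly _ _)).
- by rewrite (leq_trans (size_poly _ _)).
move=> k k0; rewrite (ehrhart_polyE ehrC) ?(ehrhart_polyE ehrC); first last.
- by move=> i; exact: CTd.
- by move=> i; rewrite addnAC n0K -addnA -mulnDl CTd.
rewrite ler_nat; apply: lattice_count_slice_le => //; last exact: K0P.
  by rewrite addn_gt0 muln_gt0 k0 T_gt0 orbT.
by rewrite natrD natrM mulrDr mulrCA rpredD // rpredM // rpred_nat.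
Qed.

End Slice.

(* The ambient dimension is d.+1 >= 1, so the indices 0, ..., d range over the
   possible degrees for the slices. *)
Theorem theorem4p16 (R : realType) (d : nat) (P : set 'rV[R]_d.+1)
    (ratP : rational_polytope P) (dimP : affine_dim P = d.+1) :
  exists (c : nat -> R) (ctop : set 'rV[R]_d.+1 -> R),
    forall (lambda : rat), 0 <= lambda ->
    forall (i : nat), (i <= d)%N ->
    forall (n : nat), lambda * n%:R \is a Num.nat ->
      `|ehrhart_coef (slice P lambda) i n| <= c i /\
      ehrhart_coef (slice P lambda) d n = ctop (slice P lambda).
Proof.
have [c cP] := slice_coef_bounded ratP.
(* n = 0 makes lambda n an integer for every lambda *)
exists c, (fun Q => ehrhart_coef Q d 0) => lam _ i _ n lamn; split.
  exact: cP.
have [ehrC|C0] := ehrhart_coefP (slice P lam); last by rewrite !C0.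
have lamn' : lam * n%:R \is a Num.int by rewrite intr_nat.
have lam0' : lam * 0%:R \is a Num.int by rewrite mulr0 rpred0.
by apply/eqP; rewrite eq_le !(slice_top_coef_le ratP ehrC).
Qed.
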